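(* There is no class $\mathcal{C}$ of functions (between products of two Polish spaces) such that, for all Polish spaces $X,Y,Z,T$, every Borel subset $A$ of $X\times Y$ and every Borel subset $B$ of $Z\times T$, the inclusion $\Gamma_A\subseteq\Gamma_B$ is equivalent to the existence of a function $f:X\times Y\to Z\times T$ in $\mathcal{C}$ such that $A=f^{-1}(B)$.
   Context: Wadge classes: if $A_0$ is a Borel subset of a zero-dimensional Polish space $P_0$, the Wadge class $\langle A_0\rangle$ generated by $A_0$ is the family of all Borel subsets $A$ of zero-dimensional Polish spaces $P$ such that $A=f^{-1}(A_0)$ for some continuous $f:P\to P_0$. A Wadge class is a family of this form. Potential classes: let $X,Y$ be Polish spaces, $A\subseteq X\times Y$ Borel and $\Gamma$ a Wadge class. $A$ is potentially in $\Gamma$, written $A\in\mathrm{pot}(\Gamma)$, if there are zero-dimensional Polish topologies $\sigma$ on $X$ and $\tau$ on $Y$, finer than the original topologies, such that $A$, seen as a subset of $(X,\sigma)\times(Y,\tau)$, is in $\Gamma$. For each Borel subset $A$ of a product of two Polish spaces, $\Gamma_A$ (the potential Wadge class of $A$) denotes the unique Wadge class such that $A\in\mathrm{pot}(\Gamma_A)$ and $A\notin\mathrm{pot}(\Gamma)$ for every Wadge class $\Gamma$ strictly contained in $\Gamma_A$.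
   Formalization: The class C is taken either as a class of bare maps between underlying sets (membership independent of the topologies), or as a class whose membership may depend on the topologies but which consists of Borel functions; for topology-dependent classes of arbitrary functions the claim fails. *)

(* Defs.v *)
(* MathComp-Analysis *)
From HB Require Import structures.
From mathcomp Require Import all_boot all_order all_algebra.
From mathcomp Require Import all_classical all_reals all_analysis.

Set Implicit Arguments.
Unset Strict Implicit.
Unset Printing Implicit Defensive.

Import Order.TTheory GRing.Theory Num.Theory.
Local Open Scope classical_set_scope.
Local Open Scope ring_scope.

(* R only serves as the codomain of the metrics; all its instances are
   isomorphic, so that nothing below depends on the choice of R. *)

Definition is_metric (R : realType) (T : Type) (d : T -> T -> R) : Prop :=
  [/\ forall x y, 0 <= d x y,
      forall x y, d x y = 0 <-> x = y,
      forall x y, d x y = d y x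
    & forall x y z, d x z <= d x y + d y z].

Definition metric_compatible (R : realType) (T : topologicalType)
    (d : T -> T -> R) : Prop :=
  forall U : set T, open U <->
    (forall x, U x -> exists2 e : R, 0 < e & [set y | d x y < e] `<=` U).

Definition metric_complete (R : realType) (T : topologicalType)
    (d : T -> T -> R) : Prop :=
  forall u : nat -> T,
    (forall e : R, 0 < e -> exists N : nat, forall m n : nat,
       (N <= m)%N -> (N <= n)%N -> d (u m) (u n) < e) ->
    exists l : T, u @ \oo --> l.

Definition polish (R : realType) (T : topologicalType) : Prop :=
  (exists2 D : set T, countable D & dense D) /\
  (exists d : T -> T -> R,
     [/\ is_metric d, metric_compatible d & metric_complete d]).

(* The library's zero_dimensional only asks that clopen sets separate points,
   which for Polish spaces is weaker than having a base of clopen sets. *)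
Definition zd_polish (R : realType) (T : topologicalType) : Prop :=
  polish R T /\ basis (@clopen T).

Definition borel (T : topologicalType) (A : set T) : Prop :=
  <<s (@open T) >> A.

Definition borel_fun (S T : topologicalType) (f : S -> T) : Prop :=
  forall B : set T, borel B -> borel (f @^-1` B).

(* A family of subsets of topological spaces: Gamma P A means that A, as a
   subset of the space P, belongs to Gamma. *)
Definition pointclass := forall P : topologicalType, set P -> Prop.

Definition pc_sub (Gamma Gamma' : pointclass) : Prop :=
  forall (P : topologicalType) (A : set P), Gamma P A -> Gamma' P A.

Definition pc_ssub (Gamma Gamma' : pointclass) : Prop :=
  pc_sub Gamma Gamma' /\ ~ pc_sub Gamma' Gamma.

Definition wadge_gen (R : realType) (P0 : topologicalType) (A0 : set P0) :
    pointclass :=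
  fun P A => [/\ zd_polish R P, borel A
    & exists2 f : P -> P0, continuous f & A = f @^-1` A0].

Definition wadge_class (R : realType) (Gamma : pointclass) : Prop :=
  exists (P0 : topologicalType) (A0 : set P0),
    [/\ zd_polish R P0, borel A0 & Gamma = wadge_gen R A0].

(* A topology on the bare type X, and X equipped with it.  The carrier of
   space_of sigma is convertible to X, so that subsets of X and of
   space_of sigma are the same objects. *)
Definition topology_on (X : Type) := Topological.axioms_ X.

Definition space_of (X : Type) (sigma : topology_on X) : topologicalType :=
  Topological.Pack sigma.

Definition finer (X : topologicalType) (sigma : topology_on X) : Prop :=
  forall U : set X, open U -> @open (space_of sigma) U.

Definition pot (R : realType) (Gamma : pointclass) (X Y : topologicalType)
    (A : set (X * Y)) : Prop :=
  exists (sigma : topology_on X) (tau : topology_on Y),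
    [/\ finer sigma /\ zd_polish R (space_of sigma),
        finer tau /\ zd_polish R (space_of tau)
      & Gamma (space_of sigma * space_of tau)%type A].

Definition potential_wadge_class (R : realType) (X Y : topologicalType)
    (A : set (X * Y)) (Gamma : pointclass) : Prop :=
  [/\ wadge_class R Gamma, pot R Gamma A
    & forall Gamma', wadge_class R Gamma' -> pc_ssub Gamma' Gamma ->
        ~ pot R Gamma' A].

(* "Gamma_A is contained in Gamma_B".  Gamma_A and Gamma_B are definite
   descriptions, eliminated in Russell's way: their existence and uniqueness
   for Borel sets are theorems of the theory of Wadge classes. *)
Definition potential_wadge_class_le (R : realType) (X Y Z T : topologicalType)
    (A : set (X * Y)) (B : set (Z * T)) : Prop :=
  exists GammaA GammaB : pointclass,
    [/\ potential_wadge_class R A GammaA, potential_wadge_class R B GammaB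
      & pc_sub GammaA GammaB].

(* Classes of functions between products.  In a fun_class, as in set theory,
   a function is just a map between the underlying sets, and does not carry any
   topology.  In a top_fun_class, membership may also depend on the topologies
   of the four spaces, as for continuous or Borel functions. *)
Definition fun_class :=
  forall X Y Z T : Type, (X * Y -> Z * T) -> Prop.

Definition top_fun_class :=
  forall X Y Z T : topologicalType, (X * Y -> Z * T) -> Prop.

Definition top_of_fun_class (C : fun_class) : top_fun_class :=
  fun X Y Z T f => C X Y Z T f.

Definition borel_fun_class (R : realType) (C : top_fun_class) : Prop :=
  forall X Y Z T : topologicalType,
    polish R X -> polish R Y -> polish R Z -> polish R T ->
    forall f : X * Y -> Z * T, C X Y Z T f -> borel_fun f.

Definition characterizes_inclusion (R : realType) (C : top_fun_class) : Prop :=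
  forall X Y Z T : topologicalType,
    polish R X -> polish R Y -> polish R Z -> polish R T ->
    forall (A : set (X * Y)) (B : set (Z * T)), borel A -> borel B ->
      (potential_wadge_class_le R A B <->
       exists f : X * Y -> Z * T, C X Y Z T f /\ A = f @^-1` B).

(* Main.v *)
Require Import Defs.
From HB Require Import structures.
From mathcomp Require Import all_boot all_order all_algebra.
From mathcomp Require Import all_classical all_reals all_analysis.

(** The proof takes place on the Cantor space, with two subsets of its square:
    equality, and the graph [bit_adjacent] of the pairs that differ at exactly
    one coordinate.  Adjacency is closed up to the diagonal, where it
    accumulates, because flipping the n-th bit of a point moves it less and less
    as n grows.  A finer Polish topology agrees with the usual one off a meager
    set ([finer_polish_generic]), so for some point a the flips of a still tend
    to a in finer topologies ([finer_polish_flip]): adjacency is not potentially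
    closed.

    Functions between bare sets.  The components of the graph are countable.
    Choose a point in each of them, identify the set of these points with the
    Cantor space by a wild bijection, and describe a point by the chosen point
    of its component and a finite set of coordinates.  This gives another Polish
    topology on the same set, for which adjacency is closed
    ([adjacent_smooth_closed]) and has the closed sets as potential class.  As
    every potential class is contained in itself, a characterizing class would
    contain a function f that reduces adjacency to itself.  Membership of f
    does not depend on topologies, so f also witnesses an inclusion for the
    usual topology on its domain and the new one on its range, and adjacency
    would be potentially closed for the usual topology, which it is not.

    Borel functions.  The potential class of equality is contained in that of
    non-adjacency ([equal_pairs_le]).  So a characterizing class would contain a
    Borel function f for which equality is the inverse image of non-adjacency.
    Since f is in the class, it cannot raise the potential class of any Borel
    set by inverse image; in particular inverse images of rectangles with
    closed sides are potentially open ([characterizes_open]).  It follows that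
    for generic a both coordinates of f (a, a) have a common value g a, which
    depends continuously on a.  A perfect set argument ([perfect_image]) finds a
    closed set E without adjacent points which contains g a for uncountably many
    a; a single point will do if g is generically constant on some cylinder.
    The inverse image of E * E is contained in the diagonal, because f maps all
    other pairs to adjacent ones; it is potentially open, and it is uncountable.
    This is absurd, since a potentially open set is a countable union of
    rectangles ([open_square]). *)

Set Implicit Arguments.
Unset Strict Implicit.
Unset Printing Implicit Defensive.

Import Order.TTheory GRing.Theory Num.Theory.
Local Open Scope classical_set_scope.
Local Open Scope ring_scope.

(** * Spaces of codes *)

Definition agree (V : Type) (n : nat) (u v : nat -> V) : Prop :=
  forall i, (i < n)%N -> u i = v i.

Lemma agreeC V n (u v : nat -> V) : agree n u v -> agree n v u.
Proof. by move=> a i /a ->. Qed.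

Lemma agree_trans V n (u v w : nat -> V) :
  agree n u v -> agree n v w -> agree n u w.
Proof. by move=> a b i i_n; rewrite a // b. Qed.

Lemma agreeW V m n (u v : nat -> V) : (m <= n)%N -> agree n u v -> agree m u v.
Proof. by move=> mn a i im; apply: a; apply: leq_trans mn. Qed.

Definition code_open (X V : Type) (c : X -> nat -> V) (U : set X) : Prop :=
  forall x, U x -> exists n, forall y, agree n (c x) (c y) -> U y.

(** The last clause says that the range of the code is closed: T is presented
    as a closed subset of the space of sequences over V.  All the
    zero-dimensional Polish spaces constructed below come in this form. *)
Definition coded (T : topologicalType) (V : Type) (c : T -> nat -> V) : Prop :=
  [/\ forall U : set T, open U <-> code_open c U,
      forall x y, (forall n, agree n (c x) (c y)) -> x = y
    & forall u, (forall n, exists x, agree n (c x) u) ->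
        exists x, forall n, agree n (c x) u].

(** An alias of X, on which the topology induced by the code can be declared. *)
Definition code_space (X V : Type) (c : X -> nat -> V) : Type := X.

Section CodeSpace.
Variables (X V : Type) (c : X -> nat -> V).

HB.instance Definition _ := gen_eqMixin (code_space c).
HB.instance Definition _ := gen_choiceMixin (code_space c).

Let code_openT : code_open c setT.
Proof. by move=> x _; exists 0%N. Qed.

Let code_openI : setI_closed (code_open c : set_system (code_space c)).
Proof.
move=> A B oA oB x [/oA[m Am] /oB[n Bn]]; exists (maxn m n) => y a.
by split; [apply: Am | apply: Bn]; apply: agreeW a; rewrite ?leq_maxl ?leq_maxr.
Qed.

Let code_open_bigU (I : Type) (f : I -> set (code_space c)) :
  (forall i, code_open c (f i)) -> code_open c (\bigcup_i f i).
Proof. by move=> of_ x [i _ /of_[n fn]]; exists n => y /fn; exists i. Qed.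

HB.instance Definition _ := isOpenTopological.Build (code_space c)
  code_openT code_openI code_open_bigU.

Lemma code_space_coded :
  (forall x y, (forall n, agree n (c x) (c y)) -> x = y) ->
  (forall u, (forall n, exists x, agree n (c x) u) ->
     exists x, forall n, agree n (c x) u) ->
  coded (c : code_space c -> _).
Proof. by []. Qed.

End CodeSpace.

Lemma inv_nat_lt (R : realType) (e : R) :
  0 < e -> exists n : nat, n.+1%:R^-1 < e.
Proof.
move=> e0; have [n _ /(_ n (leqnn n))] := near_infty_natSinv_lt (PosNum e0).
by exists n.
Qed.

Section CodedPolish.
Variables (R : realType) (T : topologicalType) (V : countType).
Variables (c : T -> nat -> V) (cT : coded c).

(** The inverse of one plus the first index at which the codes differ. *)
Definition code_dist (x y : T) : R :=
  if pselect (exists n, c x n != c y n) is left h then (ex_minn h).+1%:R^-1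
  else 0.

Lemma code_dist_le n x y :
  code_dist x y <= n.+1%:R^-1 <-> agree n (c x) (c y).
Proof.
rewrite /code_dist; case: pselect => [h|h].
  case: ex_minnP => m cm mmin.
  rewrite lef_pV2 ?posrE ?ltr0n // ler_nat ltnS; split=> [nm i i_n|a].
    apply/eqP/negPn/negP => /mmin; apply/negP; rewrite -ltnNge.
    exact: leq_trans nm.
  by rewrite leqNgt; apply/negP => /a /eqP; apply/negP.
split=> _; last by rewrite invr_ge0 ler0n.
by move=> i _; apply/eqP/negPn/negP => ?; apply: h; exists i.
Qed.

Lemma code_dist_cases x y :
  code_dist x y = 0 \/ exists n, code_dist x y = n.+1%:R^-1.
Proof.
by rewrite /code_dist; case: pselect => [h|h]; [right; exists (ex_minn h)|left].
Qed.

Lemma code_dist_ge0 x y : 0 <= code_dist x y.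
Proof.
by case: (code_dist_cases x y) => [->//|[n ->]]; rewrite invr_ge0 ler0n.
Qed.

Lemma code_dist_lt n x y :
  code_dist x y < n.+1%:R^-1 <-> agree n.+1 (c x) (c y).
Proof.
split=> [|/code_dist_le/le_lt_trans]; last first.
  by apply; rewrite ltf_pV2 ?posrE ?ltr0n // ltr_nat.
case: (code_dist_cases x y) => [d0 _|[m dm]].
  by apply/code_dist_le; rewrite d0 invr_ge0 ler0n.
rewrite dm ltf_pV2 ?posrE ?ltr0n // ltr_nat => nm.
by apply/code_dist_le; rewrite dm lef_pV2 ?posrE ?ltr0n // ler_nat.
Qed.

(** The distance only depends on the set of lengths on which the codes agree.
    As agreement up to n is an equivalence relation, this makes the distance
    an ultrametric. *)
Lemma code_dist_mono x y x' y' :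
  (forall n, agree n (c x) (c y) -> agree n (c x') (c y')) ->
  code_dist x' y' <= code_dist x y.
Proof.
move=> h; case: (code_dist_cases x y) => [d0|[n dn]]; last first.
  by rewrite dn; apply/code_dist_le/h/code_dist_le; rewrite dn.
case: (code_dist_cases x' y') => [->|[n dn]]; first by rewrite d0.
suff : code_dist x' y' <= n.+2%:R^-1.
  by rewrite dn lef_pV2 ?posrE ?ltr0n // ler_nat ltnn.
by apply/code_dist_le/h/code_dist_le; rewrite d0 invr_ge0 ler0n.
Qed.

Lemma code_dist_metric : is_metric code_dist.
Proof.
have [_ inj _] := cT; split=> [||x y|x y z].
- exact: code_dist_ge0.
- move=> x y; split=> [d0|->].
    by apply: inj => n; apply/code_dist_le; rewrite d0 invr_ge0 ler0n.
  case: (code_dist_cases y y) => // -[n dn].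
  have : code_dist y y <= n.+2%:R^-1 by apply/code_dist_le.
  by rewrite dn lef_pV2 ?posrE ?ltr0n // ler_nat ltnn.
- by apply/eqP; rewrite eq_le !code_dist_mono // => n; exact: agreeC.
- case/orP: (le_total (code_dist x y) (code_dist y z)) => le_d.
    apply: (@le_trans _ _ (code_dist y z)); last by rewrite lerDr code_dist_ge0.
    apply: code_dist_mono => n a; apply: (agree_trans _ (a)).
    by move/code_dist_le: a => /(le_trans le_d)/code_dist_le.
  apply: (@le_trans _ _ (code_dist x y)); last by rewrite lerDl code_dist_ge0.
  apply: code_dist_mono => n a; apply: (agree_trans a).
  by move/code_dist_le: a => /(le_trans le_d)/code_dist_le.
Qed.

Lemma code_dist_compatible : metric_compatible code_dist.
Proof.
move=> U; have [opn _ _] := cT; rewrite opn; split=> oU x Ux.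
  have [n Un] := oU x Ux; exists n.+1%:R^-1; first by rewrite invr_gt0 ltr0n.
  by move=> y /= /code_dist_lt a; apply: Un; apply: agreeW a.
have [e e0 Ue] := oU x Ux; have [n ne] := inv_nat_lt e0.
by exists n => y /code_dist_le a; apply: Ue => /=; apply: le_lt_trans ne.
Qed.

Lemma code_cvg (u : nat -> T) (l : T) :
  (forall n, exists N, forall m, (N <= m)%N -> agree n (c l) (c (u m))) ->
  u @ \oo --> l.
Proof.
have [opn _ _] := cT; move=> h A; rewrite nbhsE => -[B [oB Bl] BA].
have [n nB] := (opn B).1 oB l Bl; have [N hN] := h n.
by exists N => // m /hN /nB /BA.
Qed.

Lemma code_dist_complete : metric_complete code_dist.
Proof.
have [_ _ cl] := cT; move=> u cu.
have cu' n : exists N, forall m p, (N <= m)%N -> (N <= p)%N ->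
    agree n (c (u m)) (c (u p)).
  have [N hN] := cu n.+1%:R^-1 ltac:(by rewrite invr_gt0 ltr0n).
  by exists N => m p Nm Np; apply/code_dist_le/ltW/hN.
have [N hN] := choice cu'.
(* From the index N k on, the first k terms of the codes are constant. *)
have [l hl] : exists x, forall n, agree n (c x) (fun i => c (u (N i.+1)) i).
  apply: cl => n; exists (u (\max_(i < n) N i.+1)) => i i_n.
  apply: (hN i.+1) => //.
  exact: (leq_bigmax (Ordinal i_n) (F := fun i : 'I_n => N i.+1)).
exists l; apply: code_cvg => n; exists (\max_(i < n) N i.+1) => m nm i i_n.
rewrite (hl i.+1) //; apply: (hN i.+1) => //; apply: leq_trans nm.
exact: (leq_bigmax (Ordinal i_n) (F := fun i : 'I_n => N i.+1)).
Qed.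

Lemma coded_dense : exists2 D : set T, countable D & dense D.
Proof.
have [opn _ _] := cT.
pose P (s : seq V) (x : T) := mkseq (c x) (size s) = s.
pose pick s : option T :=
  if pselect (exists x, P s x) is left h then Some (projT1 (cid h)) else None.
exists [set x | exists s, pick s = Some x].
  have -> : [set x | exists s, pick s = Some x] =
      \bigcup_(s in [set: seq V]) [set x | pick s = Some x].
    by apply/seteqP; split=> x /= => [[s]|[s _]]; exists s.
  apply: bigcup_countable => [|s _]; first exact: countableP.
  case e: (pick s) => [x|].
    rewrite (_ : [set _ | _] = [set x]); first exact: countable1.
    by apply/seteqP; split=> y /= => [[]|->].
  rewrite (_ : [set _ | _] = set0); first exact: countable0.
  by apply/seteqP; split=> y.
move=> O [x Ox] oO; have [n On] := (opn O).1 oO x Ox.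
pose s := mkseq (c x) n.
have Ps : exists y, P s y by exists x; rewrite /P size_mkseq.
have [y Py py] : exists2 y, P s y & pick s = Some y.
  rewrite /pick; case: pselect => // h; exists (projT1 (cid h)) => //.
  exact: (projT2 (cid h)).
exists y; split; last by exists s.
apply: On => i i_n; have := congr1 (nth (c x 0%N) ^~ i) Py.
by rewrite /s size_mkseq !nth_mkseq.
Qed.

Lemma coded_clopen n x : clopen [set y | agree n (c x) (c y)].
Proof.
have [opn _ _] := cT; split.
  by apply/opn => y /= xy; exists n => z yz; exact: agree_trans yz.
rewrite -[X in closed X]setCK; apply: open_closedC; apply/opn => y /= xy.
by exists n => z yz xz; apply: xy; apply: agree_trans xz (agreeC yz).
Qed.

Lemma coded_zd_polish : zd_polish R T.
Proof.
split; first split; first exact: coded_dense.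
  exists code_dist; split; [exact: code_dist_metric|
    exact: code_dist_compatible|exact: code_dist_complete].
split=> [A []//|x A]; rewrite nbhsE => -[B [oB Bx] BA].
have [opn _ _] := cT; have [n nB] := (opn B).1 oB x Bx.
exists [set y | agree n (c x) (c y)]; last by move=> y /nB/BA.
by split=> //; exact: coded_clopen.
Qed.

End CodedPolish.

Lemma prod_openP (X Y : topologicalType) (A : set (X * Y)) :
  open A <-> forall p, A p -> exists U V,
    [/\ open U, open V, U p.1, V p.2 & forall x y, U x -> V y -> A (x, y)].
Proof.
rewrite openE; split=> [oA p /oA|h p /h[U [V [oU oV Up Vp UVA]]]].
  rewrite /interior => -[[P Q] /= [Pp Qp] PQ].
  move: Pp Qp; rewrite !nbhsE => -[U [oU Up] UP] [V [oV Vp] VQ].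
  by exists U, V; split=> // x y /UP Px /VQ Qy; apply: PQ.
exists (U, V); first by split; exact: open_nbhs_nbhs.
by move=> [x y] [/= Ux Vy]; exact: UVA.
Qed.

Definition pair_code (X Y V W : Type) (c : X -> nat -> V) (d : Y -> nat -> W)
  (p : X * Y) (n : nat) : V * W := (c p.1 n, d p.2 n).

Lemma agree_pair (X Y V W : Type) (c : X -> nat -> V) (d : Y -> nat -> W) n p q :
  agree n (pair_code c d p) (pair_code c d q) <->
  agree n (c p.1) (c q.1) /\ agree n (d p.2) (d q.2).
Proof.
split=> [a|[a b] i i_n]; last by rewrite /pair_code a // b.
by split=> i /a; rewrite /pair_code => -[].
Qed.

Lemma coded_prod (X Y : topologicalType) (V W : Type)
    (c : X -> nat -> V) (d : Y -> nat -> W) :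
  coded c -> coded d -> coded (pair_code c d : (X * Y)%type -> _).
Proof.
move=> [oc injc clc] [od injd cld]; split.
- move=> A; rewrite prod_openP; split=> oA p Ap.
    have [U [V' [/oc oU /od oV Up Vp UVA]]] := oA p Ap.
    have [m Um] := oU _ Up; have [n Vn] := oV _ Vp.
    exists (maxn m n) => -[x y] /agree_pair[/= a b].
    apply: UVA; [apply: Um; apply: agreeW a|apply: Vn; apply: agreeW b].
      exact: leq_maxl.
    exact: leq_maxr.
  have [n An] := oA p Ap.
  exists [set x | agree n (c p.1) (c x)], [set y | agree n (d p.2) (d y)].
  split=> //.
  + by apply/oc => y /= xy; exists n => z yz; exact: agree_trans yz.
  + by apply/od => y /= xy; exists n => z yz; exact: agree_trans yz.
  + by move=> x y a b; apply: An; apply/agree_pair.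
- move=> [x y] [x' y'] a; congr pair.
    by apply: injc => n; have /agree_pair[] := a n.
  by apply: injd => n; have /agree_pair[] := a n.
- move=> u hu.
  have [x hx] : exists x, forall n, agree n (c x) (fst \o u).
    apply: clc => n; have [p hp] := hu n.
    by exists p.1 => i /hp /= <-.
  have [y hy] : exists y, forall n, agree n (d y) (snd \o u).
    apply: cld => n; have [p hp] := hu n.
    by exists p.2 => i /hp /= <-.
  exists (x, y) => n i i_n; rewrite /pair_code /= (hx n) // (hy n) //=.
  by case: (u i).
Qed.

(** * Category in the Cantor space *)

(** The identity, in its role of a code. *)
Definition bits (x : nat -> bool) : nat -> bool := x.

Definition cantor : topologicalType := code_space bits.

Lemma cantor_coded : coded (bits : cantor -> _).
Proof.
apply: code_space_coded => [x y xy|u _]; last by exists u.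
by apply/funext => n; exact: (xy n.+1).
Qed.

Definition cyl (s : seq bool) : set cantor :=
  [set x | agree (size s) (nth false s) x].

Lemma cyl_mkseq (x y : cantor) n : cyl (mkseq x n) y <-> agree n x y.
Proof.
rewrite /cyl /= size_mkseq.
by split=> a i i_n; rewrite -(a i i_n) nth_mkseq.
Qed.

Lemma cyl_cat s t x : cyl (s ++ t) x -> cyl s x.
Proof.
move=> a i i_s; rewrite -(a i) ?nth_cat ?i_s // size_cat.
exact: leq_trans (leq_addr _ _).
Qed.

Lemma cyl_prefix s (x : cantor) n :
  cyl s x -> (size s <= n)%N -> exists t, mkseq x n = s ++ t.
Proof.
move=> sx sn; exists (drop (size s) (mkseq x n)).
rewrite -{1}(cat_take_drop (size s) (mkseq x n)); congr cat.
have sz : size (take (size s) (mkseq x n)) = size s.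
  by rewrite size_takel // size_mkseq.
apply: (@eq_from_nth _ false) => // i; rewrite sz => i_s.
by rewrite nth_take // nth_mkseq ?sx //; exact: leq_trans sn.
Qed.

Definition nowhere_dense (N : set cantor) : Prop :=
  forall s, exists t, forall x, cyl (s ++ t) x -> ~ N x.

Definition meager (M : set cantor) : Prop :=
  exists N : nat -> set cantor,
    (forall n, nowhere_dense (N n)) /\ M `<=` \bigcup_n N n.

Lemma meagerS (M M' : set cantor) : M `<=` M' -> meager M' -> meager M.
Proof. by move=> MM' [N [hN M'N]]; exists N; split=> // x /MM'/M'N. Qed.

Lemma nowhere_dense_meager N : nowhere_dense N -> meager N.
Proof. by move=> hN; exists (fun=> N); split=> // x Nx; exists 0%N. Qed.

Lemma meager0 : meager set0.
Proof. by apply: nowhere_dense_meager => s; exists [::] => x _ []. Qed.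

Lemma meager_bigcup (I : countType) (M : I -> set cantor) :
  (forall i, meager (M i)) -> meager (\bigcup_i M i).
Proof.
move=> /choice[N hN].
exists (fun n => if unpickle n is Some (i, j) then N i j else set0); split.
  move=> n; case: unpickle => [[i j]|]; first exact: (hN i).1.
  by move=> s; exists [::] => x _ [].
move=> x [i _ /(hN i).2[j _ Nx]]; exists (pickle (i, j)) => //=.
by rewrite pickleK.
Qed.

Lemma meagerU M M' : meager M -> meager M' -> meager (M `|` M').
Proof.
move=> hM hM'; have /meager_bigcup : forall b : bool, meager (if b then M else M').
  by case.
by apply: meagerS => x [Mx|Mx]; [exists true|exists false].
Qed.

Lemma meager1 (a : cantor) : meager [set a].
Proof.
apply: nowhere_dense_meager => s; exists [:: ~~ a (size s)] => x sx /= xa.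
have := sx (size s); rewrite size_cat addn1 ltnSn nth_cat ltnn subnn xa => /(_ isT).
by case: (a _).
Qed.

Lemma meager_countable (A : set cantor) : countable A -> meager A.
Proof.
move=> /countable_injP[f finj].
have /meager_bigcup : forall n : nat, meager [set x | A x /\ f x = n].
  move=> n; have [[a [Aa fa]]|no] := pselect (exists a, A a /\ f a = n).
    apply: meagerS (meager1 a) => x [Ax fx] /=.
    by apply: finj; rewrite ?inE // fx fa.
  by apply: meagerS meager0 => x ?; apply: no; exists x.
by apply: meagerS => x Ax; exists (f x).
Qed.

(** The i-th bit of the limit of a chain of nodes may be read off the node of
    index i + 1, which is long enough to have such a bit. *)
Lemma cyl_chain (w : nat -> seq bool) :
  (forall n, exists t, w n.+1 = w n ++ t) -> (forall n, (n <= size (w n))%N) ->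
  forall n, cyl (w n) (fun i => nth false (w i.+1) i : bool).
Proof.
move=> wS wsz.
have wle m n : (m <= n)%N -> exists t, w n = w m ++ t.
  elim: n => [|n IH]; first by rewrite leqn0 => /eqP->; exists [::]; rewrite cats0.
  rewrite leq_eqVlt => /orP[/eqP->|]; first by exists [::]; rewrite cats0.
  rewrite ltnS => /IH[t wn]; have [t' ->] := wS n.
  by exists (t ++ t'); rewrite wn catA.
have wnth m n i : (m <= n)%N -> (i < size (w m))%N ->
    nth false (w n) i = nth false (w m) i.
  by move=> /wle[t ->] im; rewrite nth_cat im.
move=> n i i_n; case: (leqP n i.+1) => ni; first by rewrite (wnth n i.+1).
by rewrite (wnth i.+1 n) // ltnW.
Qed.

(** The appended bit makes the lengths of the nodes unbounded. *)
Lemma baire M s : meager M -> exists2 x, cyl s x & ~ M x.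
Proof.
move=> [N [hN MN]].
have /choice[t ht] : forall p : nat * seq bool, exists t, forall x,
  cyl (p.2 ++ t) x -> ~ N p.1 x by move=> [n u]; exact: hN.
pose w := fix w n := if n is m.+1 then
  (w m ++ [:: false]) ++ t (m, w m ++ [:: false]) else s.
have wS n : exists u, w n.+1 = w n ++ u.
  by eexists; rewrite /= -catA; reflexivity.
have wsz n : (n <= size (w n))%N.
  elim: n => //= n IH; rewrite !size_cat /= addn1.
  by apply: leq_trans (leq_addr _ _); rewrite ltnS.
have cw := cyl_chain wS wsz.
eexists; first exact: (cw 0%N).
by move=> /MN[n _]; apply: (ht (n, w n ++ [:: false])); exact: (cw n.+1).
Qed.

Lemma nonmeager_uncountable M s :
  meager M -> ~ countable (cyl s `\` M).
Proof.
move=> hM /meager_countable /(meagerU hM)/(@baire _ s)[x sx]; apply.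
by have [Mx|nMx] := pselect (M x); [left|right].
Qed.

Definition flip (n : nat) (x : cantor) : cantor := fun i => x i (+) (i == n).

Lemma flipK n : involutive (flip n).
Proof.
by move=> x; apply/funext => i; rewrite /flip -addbA addbb addbF.
Qed.

Lemma flip_agree n x : agree n x (flip n x).
Proof. by move=> i i_n; rewrite /flip (ltn_eqF i_n) addbF. Qed.

Lemma meager_flip n M : meager M -> meager (flip n @^-1` M).
Proof.
move=> [N [hN MN]]; exists (fun m => flip n @^-1` N m); split; last first.
  by move=> x /MN[m _ Nm]; exists m.
move=> m s; pose u := s ++ nseq n.+1 false.
have [t ht] := hN m (mkseq (flip n (nth false u)) (size u)).
exists (nseq n.+1 false ++ t) => x; rewrite catA -/u => ux; apply: ht => i.
rewrite size_cat size_mkseq => i_s.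
have -> : flip n x i = nth false (u ++ t) i (+) (i == n).
  by rewrite ux // size_cat.
rewrite (nth_cat _ u) nth_cat size_mkseq; case: ifP => iu; first by rewrite nth_mkseq.
have ui : (size u <= i)%N by rewrite leqNgt iu.
by rewrite gtn_eqF ?addbF // (leq_trans _ ui) // size_cat size_nseq leq_addl.
Qed.

(** * Hulls and nowhere meager sets *)

(** The hull of S is closed, contains S up to a meager set, and lies in the
    closure of S.  It plays the role of a least set with the Baire property
    around S. *)
Definition hull (S : set cantor) : set cantor :=
  [set x | forall n, ~ meager (S `&` [set y | agree n x y])].

Lemma hull_open_compl S x : ~ hull S x ->
  exists n, forall y, agree n x y -> ~ hull S y.
Proof.
move=> /existsNP[n /contrapT mn]; exists n => y xy /(_ n); apply.
by apply: meagerS mn => z [Sz yz]; split=> //=; exact: agree_trans yz.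
Qed.

Lemma meager_small_part S :
  meager [set x | S x /\ exists2 s, meager (S `&` cyl s) & cyl s x].
Proof.
have /meager_bigcup : forall s : seq bool,
    meager [set x | meager (S `&` cyl s) /\ (S `&` cyl s) x].
  move=> s; have [ms|nms] := pselect (meager (S `&` cyl s)).
    by apply: meagerS ms => x [].
  by apply: meagerS meager0 => x [].
by apply: meagerS => x [Sx [s ms sx]]; exists s.
Qed.

Lemma meager_setDhull S : meager (S `\` hull S).
Proof.
apply: meagerS (meager_small_part S) => x [Sx /existsNP[n /contrapT mn]].
split=> //; exists (mkseq x n); last exact/cyl_mkseq.
by apply: meagerS mn => y [Sy /cyl_mkseq].
Qed.

(** If S were meager in some cylinder below each node, then S would be meager:
    these cylinders cover all but a nowhere dense set. *)
Lemma nonmeager_everywhere S s : ~ meager (S `&` cyl s) ->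
  exists t, forall u, ~ meager (S `&` cyl (s ++ t ++ u)).
Proof.
move=> nm; apply/not_existsP => no; apply: nm.
have {}no t : exists u, meager (S `&` cyl (s ++ t ++ u)).
  by have /existsNP[u /contrapT] := no t; exists u.
have m2 : nowhere_dense
    (cyl s `\` \bigcup_(v in [set v | meager (S `&` cyl v)]) cyl v).
  move=> v; case: (leqP (size s) (size v)) => sv.
    have [vs|vs] := pselect (cyl s (nth false v)).
      have [t vE] := cyl_prefix vs sv.
      rewrite mkseq_nth in vE; have [u mu] := no t; exists u => x vx [_]; apply.
      by exists (s ++ t ++ u) => //; rewrite catA -vE.
    exists [::] => x; rewrite cats0 => vx [sx _]; apply: vs => i i_s.
    by rewrite sx // -vx //; exact: leq_trans sv.
  have [vs|vs] := pselect (cyl v (nth false s)).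
    have [t sE] := cyl_prefix vs (ltnW sv); rewrite mkseq_nth in sE.
    have [u mu] := no [::]; exists (t ++ u) => x; rewrite catA -sE => sx [_].
    by apply; exists (s ++ u).
  exists [::] => x; rewrite cats0 => vx [sx _]; apply: vs => i i_s.
  by rewrite vx // -sx //; exact: ltn_trans sv.
apply: meagerS (meagerU (meager_small_part S) (nowhere_dense_meager m2)) => x [Sx sx].
have [[v vm vx]|nv] := pselect
    ((\bigcup_(v in [set v | meager (S `&` cyl v)]) cyl v) x).
  by left; split=> //; exists v.
by right.
Qed.

(** In a cylinder where S is not meager, some F i is not meager either, and
    then the hull of this F i contains a whole smaller cylinder. *)
Lemma nowhere_dense_hull (I : countType) (S : set cantor)
    (F : I -> set cantor) : S `<=` \bigcup_i F i ->
  nowhere_dense (hull S `\` \bigcup_i hull (F i)).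
Proof.
move=> SF s.
have [ms|nms] := pselect (meager (S `&` cyl s)).
  exists [::] => x; rewrite cats0 => sx [/(_ (size s))]; case; apply: meagerS ms.
  by move=> y [Sy xy]; split=> //; exact: agree_trans xy.
have [i nmi] : exists i, ~ meager (F i `&` cyl s).
  apply/not_existsP => no; apply: nms.
  have /meager_bigcup : forall i, meager (F i `&` cyl s).
    by move=> i; apply: contrapT; exact: no.
  by apply: meagerS => x [/SF[i _ Fx] sx]; exists i.
have [t ht] := nonmeager_everywhere nmi; exists t => x sx [_]; apply.
exists i => // n nm; case: (leqP (size (s ++ t)) n) => stn.
  have [u xE] := cyl_prefix sx stn; apply: (ht u); apply: meagerS nm => y [Fy].
  by rewrite catA -xE => /cyl_mkseq.
apply: (ht [::]); rewrite cats0; apply: meagerS nm => y [Fy sy]; split=> //=.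
by move=> i' i'n; rewrite -sx ?sy //; exact: ltn_trans stn.
Qed.

(** * Generic agreement with finer Polish topologies *)

Section Metric.
Variables (R : realType) (T : topologicalType) (d : T -> T -> R).
Hypotheses (md : is_metric d) (cd : metric_compatible d).

Lemma ball_open x e : open [set y | d x y < e].
Proof.
have [_ _ _ tri] := md; apply/cd => y /= xy.
exists (e - d x y); first by rewrite subr_gt0.
by move=> z /= yz; rewrite (le_lt_trans (tri x y z)) // addrC -ltrBrDr.
Qed.

Lemma metric_dense_ball (D : set T) x (e : R) : dense D -> 0 < e ->
  exists2 y, D y & d y x < e.
Proof.
have [_ d0 sym _] := md => dD e0.
have [|y [xy Dy]] := dD _ _ (ball_open x e).
  by exists x; rewrite /= (d0 x x).2.
by exists y; rewrite // sym.
Qed.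

End Metric.

(** For a fixed injective numbering f of a dense set, the balls of radius
    1 / (k + 1) around the point number i form a base. *)
Lemma polish_base (R : realType) (T : topologicalType) : polish R T ->
  exists B : nat -> set T, (forall i, open (B i)) /\
    forall U x, open U -> U x -> exists i, B i x /\ B i `<=` U.
Proof.
move=> [[D /countable_injP[f finj] dD] [d [md cd _]]].
have [_ d0 sym tri] := md.
pose ball i (k : nat) : set T :=
  \bigcup_(y in [set y | D y /\ f y = i]) [set z | d y z < k.+1%:R^-1].
exists (fun n => if unpickle n is Some (i, k) then ball i k else set0); split.
  move=> n; case: unpickle => [[i k]|]; last exact: open0.
  by apply: bigcup_open => y _; exact: (ball_open md cd).
move=> U x oU Ux; have [e e0 eU] := (cd U).1 oU x Ux.
have [k ke] := @inv_nat_lt R (e / 2) ltac:(by rewrite divr_gt0).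
have [y Dy yx] := @metric_dense_ball _ _ _ md cd D x k.+1%:R^-1 dD
  ltac:(by rewrite invr_gt0 ltr0n).
exists (pickle (f y, k)); rewrite pickleK; split; first by exists y.
move=> z [y' [Dy' fy'] /= yz]; apply: eU => /=.
have yy' : y' = y by apply: finj; rewrite ?inE.
rewrite yy' in yz; apply: (le_lt_trans (tri x y z)).
by rewrite [e]splitr ltrD // ?(sym x y); apply: lt_trans ke.
Qed.

Lemma cantor_cvg_unique (u : nat -> cantor) (x y : cantor) :
  u @ \oo --> y -> (forall n, agree n x (u n)) -> x = y.
Proof.
have [oc ic _] := cantor_coded => uy ux; apply: ic => n i i_n.
have [|N _ hN] := uy [set z | agree n y z].
  apply: open_nbhs_nbhs; split=> //; apply/oc => z /= yz; exists n => v zv.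
  exact: agree_trans yz zv.
have := hN (maxn N n) (leq_maxl _ _) i i_n; rewrite /bits => ->.
apply: ux; exact: leq_trans (leq_maxr _ _).
Qed.

Section FinerPolish.
Variables (R : realType) (sigma : topology_on cantor).
Hypotheses (fs : finer sigma) (ps : polish R (space_of sigma)).

(** This is the proof that Souslin's operation preserves the Baire property.
    Cut V into countably many sigma-small pieces, cut the pieces again, and so
    on.  Off the nowhere dense sets of [nowhere_dense_hull], a point x of the
    hull of V lies in the hulls of a decreasing sequence of pieces, whose
    sigma-diameters tend to 0.  Points of these pieces can be chosen that tend
    to x for the usual topology; by completeness they tend to a point of V for
    sigma, and the two limits agree because sigma is finer. *)
Lemma meager_hullD (V : set cantor) :
  open (~` V : set (space_of sigma)) -> meager (hull V `\` V).
Proof.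
move=> cV; have [[D /countable_injP[f finj] dD] [d [md cd cpl]]] := ps.
have [_ d0 sym tri] := md.
pose F := fix F (s : seq nat) : set cantor := if s is i :: s' then
  F s' `&` [set y | exists z, [/\ D z, f z = i & d z y < (size s').+1%:R^-1]]
  else V.
have FU s : F s `<=` \bigcup_i F (i :: s).
  move=> y Fy.
  have [z Dz zy] := @metric_dense_ball _ _ _ md cd D y (size s).+1%:R^-1 dD
    ltac:(by rewrite invr_gt0 ltr0n).
  by exists (f z) => //; split=> //; exists z.
have /meager_bigcup : forall s : seq nat,
    meager (hull (F s) `\` \bigcup_i hull (F (i :: s))).
  by move=> s; apply: nowhere_dense_meager; apply: nowhere_dense_hull.
apply: meagerS => x [hx nVx]; apply: contrapT => nx; apply: nVx.
have /choice[next hnext] : forall s, exists i,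
    hull (F s) x -> hull (F (i :: s)) x.
  move=> s; have [hs|] := pselect (hull (F s) x); last by exists 0%N.
  apply: contrapT => no; apply: nx; exists s => //; split=> // -[i _ hi].
  by apply: no; exists i.
pose t := fix t n := if n is m.+1 then next (t m) :: t m else [::].
have tx n : hull (F (t n)) x by elim: n => //= n; exact: hnext.
have tsz n : size (t n) = n by elim: n => //= n ->.
have Fle m n : (m <= n)%N -> F (t n) `<=` F (t m).
  elim: n => [|n IH]; first by rewrite leqn0 => /eqP->.
  by rewrite leq_eqVlt => /orP[/eqP->//|]; rewrite ltnS => /IH h y [/h].
have /choice[y hy] : forall n, exists y, F (t n) y /\ agree n x y.
  move=> n; apply: contrapT => no; apply: (tx n n); apply: meagerS meager0.
  by move=> y [Fy xy]; apply: no; exists y.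
have [l yl] : exists l : space_of sigma, (y : nat -> space_of sigma) @ \oo --> l.
  apply: cpl => e e0; have [k ke] := @inv_nat_lt R (e / 2) ltac:(by rewrite divr_gt0).
  exists k.+1 => m n km kn.
  have [_ [z [Dz fz zm]]] := Fle _ _ km _ (hy m).1.
  have [_ [z' [Dz' fz' zn]]] := Fle _ _ kn _ (hy n).1.
  have zz' : z' = z by apply: finj; rewrite ?inE // fz fz'.
  rewrite zz' in zn; rewrite tsz in zm zn; apply: (le_lt_trans (tri _ z _)).
  by rewrite [e]splitr ltrD // ?(sym _ z); apply: lt_trans ke.
have -> : x = l.
  apply: (@cantor_cvg_unique y x l); last by move=> n; have [] := hy n.
  move=> A; rewrite nbhsE => -[B [oB Bl] BA].
  have [|N _ hN] := yl B; first by apply: open_nbhs_nbhs; split=> //; exact: fs.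
  by exists N => // n Nn; apply: BA; exact: hN.
apply: contrapT => nVl.
have [|N _ hN] := yl (~` V); first exact: open_nbhs_nbhs.
by apply: (hN N) => //=; have [] := hy N; move=> /(Fle _ _ (leq0n N)).
Qed.

(** Off a meager set, sigma induces the usual topology: by [meager_hullD] the
    complement of each set of a countable base of sigma is closed up to a
    meager set. *)
Lemma finer_polish_generic : exists2 M, meager M &
  forall (U : set cantor) a, open (U : set (space_of sigma)) -> U a -> ~ M a ->
    exists n, forall y, agree n a y -> ~ M y -> U y.
Proof.
have [B [oB hB]] := polish_base ps.
exists (\bigcup_i ((~` B i `\` hull (~` B i)) `|` (hull (~` B i) `\` ~` B i))).
  apply: meager_bigcup => i; apply: meagerU; first exact: meager_setDhull.
  by apply: meager_hullD; rewrite setCK.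
move=> U a oU Ua Ma; have [i [Bia BiU]] := hB U a oU Ua.
have /hull_open_compl[n hn] : ~ hull (~` B i) a.
  by move=> ha; apply: Ma; exists i => //; right; split=> //; apply.
exists n => y /hn nhy My; apply: BiU; apply: contrapT => nB; apply: My.
by exists i => //; left.
Qed.

End FinerPolish.

Lemma pot_open_generic (R : realType) (sigma tau : topology_on cantor)
    (O : set (cantor * cantor)) :
  finer sigma -> polish R (space_of sigma) ->
  finer tau -> polish R (space_of tau) ->
  open (O : set (space_of sigma * space_of tau)) ->
  exists2 M, meager M & forall a, ~ M a -> O (a, a) ->
    exists n, forall x y, agree n a x -> agree n a y -> ~ M x -> ~ M y ->
      O (x, y).
Proof.
move=> fs ps ft pt oO.
have [M mM hM] := finer_polish_generic fs ps.
have [N mN hN] := finer_polish_generic ft pt.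
exists (M `|` N); first exact: meagerU.
move=> a MNa Oa; have [U [V [oU oV Ua Va UV]]] := (prod_openP _).1 oO _ Oa.
have [m hm] := hM U a oU Ua (fun h => MNa (or_introl h)).
have [n hn] := hN V a oV Va (fun h => MNa (or_intror h)).
exists (maxn m n) => x y ax ay MNx MNy; apply: UV.
  by apply: hm; [apply: agreeW ax; exact: leq_maxl|move=> h; apply: MNx; left].
by apply: hn; [apply: agreeW ay; exact: leq_maxr|move=> h; apply: MNy; right].
Qed.

(** O is a union of countably many rectangles, and one of them contains
    (x, phi x) for uncountably many x. *)
Lemma open_square (R : realType) (X Y : topologicalType) (O : set (X * Y))
    (phi : X -> Y) (S : set X) :
  polish R X -> polish R Y -> open O -> ~ countable S ->
  (forall x, S x -> O (x, phi x)) ->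
  exists W, [/\ W `<=` S, ~ countable W
    & forall x y, W x -> W y -> O (x, phi y)].
Proof.
move=> pX pY oO ncS SO; have [A [oA hA]] := polish_base pX.
have [B [oB hB]] := polish_base pY.
pose W i j := [set x | [/\ S x, A i x, B j (phi x) & A i `*` B j `<=` O]].
have SW : S `<=` \bigcup_(p in [set: nat * nat]) W p.1 p.2.
  move=> x Sx; have [U [V [oU oV Ux Vx UV]]] := (prod_openP _).1 oO _ (SO x Sx).
  have [i [Ai AU]] := hA _ _ oU Ux; have [j [Bj BV]] := hB _ _ oV Vx.
  exists (i, j) => //; split=> // -[y z] [/AU Uy /BV Vz]; exact: UV.
have [[i j] ncW] : exists p, ~ countable (W p.1 p.2).
  apply/not_existsP => no; apply: ncS; apply: sub_countable (subset_card_le SW) _.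
  by apply: bigcup_countable => [|p _]; [exact: countableP|exact: contrapT].
exists (W i j); split=> // [x []//|x y [_ Ax _ AB] [_ _ By _]].
by apply: AB.
Qed.

(** * Wadge classes and reductions *)

Lemma open_borel (T : topologicalType) (A : set T) : open A -> borel A.
Proof. by move=> oA; apply: sub_sigma_algebra. Qed.

Lemma borelC (T : topologicalType) (A : set T) : borel A -> borel (~` A).
Proof. by move=> bA; rewrite -setTD; apply: sigma_algebraCD. Qed.

Lemma closed_borel (T : topologicalType) (A : set T) : open (~` A) -> borel A.
Proof. by move=> /open_borel/borelC; rewrite setCK. Qed.

Lemma borelU (T : topologicalType) (A B : set T) :
  borel A -> borel B -> borel (A `|` B).
Proof.
move=> bA bB; rewrite -bigcup2E.
apply: (@sigma_algebra_bigcup _ setT (@open T) (bigcup2 A B)).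
by move=> [|[|n]] //; exact: sigma_algebra0.
Qed.

Section WadgeGen.
Variable R : realType.

Lemma wadge_gen_sub (P0 P1 : topologicalType) (A0 : set P0) (A1 : set P1)
    (psi : P0 -> P1) : continuous psi -> A0 = psi @^-1` A1 ->
  pc_sub (wadge_gen R A0) (wadge_gen R A1).
Proof.
move=> cpsi -> P A [zP bA [f cf AE]]; split=> //; exists (psi \o f) => //.
by move=> x; apply: continuous_comp; [exact: cf|exact: cpsi].
Qed.

Lemma wadge_gen_self (P0 : topologicalType) (A0 : set P0) :
  zd_polish R P0 -> borel A0 -> wadge_gen R A0 A0.
Proof. by move=> zP bA; split=> //; exists id => // x. Qed.

Lemma wadge_gen_is_class (P0 : topologicalType) (A0 : set P0) :
  zd_polish R P0 -> borel A0 -> wadge_class R (wadge_gen R A0).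
Proof. by move=> zP bA; exists P0, A0. Qed.

Lemma finer_refl (X : topologicalType) : finer (Topological.class X).
Proof. by []. Qed.

(** A Wadge class lying below all the classes to which A potentially belongs
    is a potential class of A, and the minimality of any other one forces the
    converse inclusion. *)
Lemma least_potential_class (X Y : topologicalType) (A : set (X * Y))
    (Gamma : pointclass) :
  wadge_class R Gamma -> pot R Gamma A ->
  (forall Gamma', wadge_class R Gamma' -> pot R Gamma' A ->
     pc_sub Gamma Gamma') ->
  potential_wadge_class R A Gamma /\
  forall Gamma', potential_wadge_class R A Gamma' -> pc_sub Gamma' Gamma.
Proof.
move=> wG pG lG; split.
  by split=> // G' wG' [_ nG] pG'; apply: nG; exact: lG.
move=> G' [wG' pG' mG']; apply: contrapT => nsub.
by apply: (mG' _ wG) pG; split=> //; exact: lG.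
Qed.

(** The class generated by A itself, in some finer topologies, is least as
    soon as every reduction of A that is continuous for even finer topologies
    can be replaced by one which is continuous for the given ones. *)
Lemma gen_least (X Y : topologicalType) (sigma : topology_on X)
    (tau : topology_on Y) (A : set (X * Y)) :
  finer sigma -> zd_polish R (space_of sigma) ->
  finer tau -> zd_polish R (space_of tau) ->
  zd_polish R (space_of sigma * space_of tau)%type ->
  borel (A : set (space_of sigma * space_of tau)) ->
  (forall (s : topology_on X) (t : topology_on Y)
      (P0 : topologicalType) (A0 : set P0)
      (theta : (space_of s * space_of t)%type -> P0),
    finer s -> zd_polish R (space_of s) ->
    finer t -> zd_polish R (space_of t) ->
    zd_polish R P0 -> continuous theta -> A = theta @^-1` A0 ->
    exists2 psi : (space_of sigma * space_of tau)%type -> P0,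
      continuous psi & A = psi @^-1` A0) ->
  let Gamma := wadge_gen R (A : set (space_of sigma * space_of tau)) in
  potential_wadge_class R A Gamma /\
  forall Gamma', potential_wadge_class R A Gamma' -> pc_sub Gamma' Gamma.
Proof.
move=> fs zs ft zt zst bA hard; apply: least_potential_class.
- exact: wadge_gen_is_class.
- by exists sigma, tau; split=> //; exact: wadge_gen_self.
move=> _ [P0 [A0 [zP bA0 ->]]] [s [t [[fs' zs'] [ft' zt']]]].
move=> [_ _ [theta ctheta Atheta]].
have [psi cpsi Apsi] := hard _ _ _ _ _ fs' zs' ft' zt' zP ctheta Atheta.
exact: wadge_gen_sub cpsi Apsi.
Qed.

End WadgeGen.

(** r p is the least length such that the cylinder of p lies in U; it is
    constant on this cylinder and tends to infinity at the boundary of U. *)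
Lemma code_rank (P : topologicalType) (V : Type) (c : P -> nat -> V)
    (U : set P) : coded c -> open U ->
  exists r : P -> nat, forall p, U p ->
    [/\ forall q, agree (r p) (c p) (c q) -> U q,
        forall q, agree (r p) (c p) (c q) -> r q = r p
      & forall q n, agree n (c p) (c q) -> ~ U q -> (n < r p)%N].
Proof.
move=> [oc _ _] /oc oU.
pose good p n := `[< forall q, agree n (c p) (c q) -> U q >].
have ex p : exists n, U p -> good p n /\ forall m, good p m -> (n <= m)%N.
  have [Up|nU] := pselect (U p); last by exists 0%N.
  have h : exists n, good p n by have [n hn] := oU p Up; exists n; apply/asboolP.
  by exists (ex_minn h) => _; case: ex_minnP.
have [r hr] := choice ex; exists r => p Up.
have [/asboolP g1 g2] := hr p Up; split=> // [q a|q n a nU]; last first.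
  by rewrite ltnNge; apply/negP => /agreeW/(_ a)/g1.
have [/asboolP q1 q2] := hr q (g1 q a).
have rqp : (r q <= r p)%N.
  by apply: q2; apply/asboolP => z qz; apply: g1; exact: agree_trans a qz.
apply/eqP; rewrite eqn_leq rqp /=; apply: g2; apply/asboolP => z pz; apply: q1.
by apply: agree_trans pz; apply: agreeC; apply: agreeW a.
Qed.

(** Points y n tending to x, each of them the limit of z n k as k grows, are a
    universal pattern for a difference of closed sets.  A point of U of rank n
    goes to y n if it is in F, and otherwise to z n (n + k), where k is its rank
    in the complement of F.  The shift by n ensures that the joint convergence
    of z n k to x applies near the complement of U. *)
Lemma ladder (P P0 : topologicalType) (V : Type) (c : P -> nat -> V)
    (U F : set P) (x : P0) (y : nat -> P0) (z : nat -> nat -> P0) :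
  coded c -> open U -> open (~` F) ->
  (forall O : set P0, open O -> O x -> exists N, forall n, (N <= n)%N -> O (y n)) ->
  (forall n (O : set P0), open O -> O (y n) ->
     exists N, forall k, (N <= k)%N -> O (z n k)) ->
  (forall O : set P0, open O -> O x ->
     exists N, forall n k, (N <= n)%N -> (N <= k)%N -> O (z n k)) ->
  exists2 psi : P -> P0, continuous psi &
    forall p, [/\ ~ U p -> psi p = x, U p -> F p -> exists n, psi p = y n
      & U p -> ~ F p -> exists n k, psi p = z n k].
Proof.
move=> cc oU oF hy hz hzx.
have [r hr] := code_rank cc oU; have [r' hr'] := code_rank cc oF.
have [oc _ _] := cc.
pose psi p := if pselect (U p) then if pselect (F p) then y (r p)
  else z (r p) (r p + r' p)%N else x.
have psix p : ~ U p -> psi p = x by rewrite /psi; case: pselect.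
have psiy p : U p -> F p -> psi p = y (r p).
  by rewrite /psi; case: pselect => //; case: pselect.
have psiz p : U p -> ~ F p -> psi p = z (r p) (r p + r' p)%N.
  by rewrite /psi; case: pselect => //; case: pselect.
exists psi; last first.
  move=> p; split; [exact: psix|by move=> Up Fp; exists (r p); exact: psiy|].
  by move=> Up Fp; exists (r p), (r p + r' p)%N; exact: psiz.
apply/continuousP => O oO; apply/oc => p Op.
have [Up|nUp] := pselect (U p); last first.
  have Ox : O x by rewrite -(psix p nUp).
  have [N1 h1] := hy _ oO Ox; have [N2 h2] := hzx _ oO Ox.
  exists (maxn N1 N2) => q pq; rewrite /preimage /=.
  have [Uq|/psix->//] := pselect (U q).
  have [_ _ /(_ p _ (agreeC pq) nUp) rq] := hr q Uq.
  have n1 : (N1 <= r q)%N by apply: leq_trans (ltnW rq); exact: leq_maxl.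
  have n2 : (N2 <= r q)%N by apply: leq_trans (ltnW rq); exact: leq_maxr.
  have [Fq|nFq] := pselect (F q); first by rewrite psiy //; exact: h1.
  by rewrite psiz //; apply: h2 => //; apply: leq_trans (leq_addr _ _).
have [rU rE _] := hr p Up.
have [Fp|nFp] := pselect (F p); last first.
  have [rF rE' _] := hr' p nFp.
  exists (maxn (r p) (r' p)) => q pq.
  have pq1 := agreeW (leq_maxl _ _) pq; have pq2 := agreeW (leq_maxr _ _) pq.
  by rewrite /preimage /= psiz ?rE ?rE' -?psiz //; [exact: rU|exact: rF].
have Oy : O (y (r p)) by rewrite -psiy.
have [N hN] := hz _ _ oO Oy; exists (maxn (r p) N) => q pq; rewrite /preimage /=.
have pq1 := agreeW (leq_maxl _ _) pq; have pq2 := agreeW (leq_maxr _ _) pq.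
have [Fq|nFq] := pselect (F q); first by rewrite psiy ?rE //; exact: rU.
rewrite psiz ?rE //; last exact: rU.
have [_ _ /(_ p _ (agreeC pq2)) rq] := hr' q nFq.
by apply: hN; apply: leq_trans (leq_addl _ _); apply: ltnW; apply: rq; apply.
Qed.

(** A set A0 that is not open has a point which is a limit of points outside
    A0.  This sequence is all that is needed to receive a closed set. *)
Lemma closed_reduces (R : realType) (P P0 : topologicalType) (V : Type)
    (c : P -> nat -> V) (F : set P) (A0 : set P0) :
  coded c -> open (~` F) -> polish R P0 -> ~ open A0 ->
  exists2 psi : P -> P0, continuous psi & F = psi @^-1` A0.
Proof.
move=> cc oF [_ [d [md cd _]]] nA; have [_ d0 _ _] := md.
have [x [Ax nx]] : exists x, A0 x /\
    forall e : R, 0 < e -> ~ [set y | d x y < e] `<=` A0.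
  apply: contrapT => no; apply: nA; apply/cd => x Ax; apply: contrapT => nex.
  by apply: no; exists x; split=> // e e0 sub; apply: nex; exists e.
have /choice[y hy] : forall n : nat, exists y, d x y < n.+1%:R^-1 /\ ~ A0 y.
  move=> n; apply: contrapT => no; apply: (nx n.+1%:R^-1).
    by rewrite invr_gt0 ltr0n.
  by move=> z /= xz; apply: contrapT => nz; apply: no; exists z.
have yx (O : set P0) : open O -> O x -> exists N, forall n, (N <= n)%N -> O (y n).
  move=> oO Ox; have [e e0 eO] := (cd O).1 oO x Ox.
  have [N hN] := inv_nat_lt e0; exists N => n Nn; apply: eO => /=.
  apply: lt_trans (hy n).1 _; apply: le_lt_trans hN.
  by rewrite lef_pV2 ?posrE ?ltr0n // ler_nat.
have [psi cpsi hpsi] : exists2 psi : P -> P0, continuous psi &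
    forall p, [/\ ~ ~ F p -> psi p = x,
      ~ F p -> setT p -> exists n, psi p = y n
      & ~ F p -> ~ setT p -> exists n k : nat, psi p = y n].
  apply: (@ladder P P0 V c (~` F) setT x y (fun n _ => y n)) => //.
  - by rewrite setCT; exact: open0.
  - by move=> n O _ Oy; exists 0%N.
  - by move=> O oO /(yx O oO)[N hN]; exists N => n k Nn _; exact: hN.
exists psi => //; apply/seteqP; split=> p.
  by move=> Fp; have [h _ _] := hpsi p; rewrite /preimage /= h // => /(_ Fp).
rewrite /preimage /=; apply: contraPP => nFp; have [_ /(_ nFp I)[n ->] _] := hpsi p.
by have [] := hy n.
Qed.

Lemma closed_potential_class (R : realType) (X Y : topologicalType)
    (V W : countType) (c : X -> nat -> V) (d : Y -> nat -> W)
    (A : set (X * Y)) :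
  coded c -> coded d -> open (~` A) ->
  (forall (s : topology_on X) (t : topology_on Y),
    finer s -> polish R (space_of s) -> finer t -> polish R (space_of t) ->
    ~ open (A : set (space_of s * space_of t))) ->
  let Gamma := wadge_gen R A in
  potential_wadge_class R A Gamma /\
  forall Gamma', potential_wadge_class R A Gamma' -> pc_sub Gamma' Gamma.
Proof.
move=> cc cd oA nopen; have ccd := coded_prod cc cd.
apply: (@gen_least R X Y (Topological.class X) (Topological.class Y)).
- exact: finer_refl.
- exact: coded_zd_polish cc.
- exact: finer_refl.
- exact: coded_zd_polish cd.
- exact: coded_zd_polish ccd.
- exact: closed_borel.
move=> s t P0 A0 theta fs [ps _] ft [pt _] [pP _] /continuousP ctheta AE.
apply: (closed_reduces ccd oA pP) => oA0.
by apply: (nopen s t fs ps ft pt); rewrite AE; exact: ctheta.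
Qed.

(** * Equality and adjacency *)

Definition equal_pairs : set (cantor * cantor) := [set p | p.1 = p.2].

(** The edges of the infinite-dimensional cube; the relation is symmetric. *)
Definition bit_adjacent : set (cantor * cantor) :=
  [set p | exists n, p.2 = flip n p.1].

Lemma neq_bit (x y : cantor) : x <> y -> exists i, x i <> y i.
Proof.
move=> xy; apply: contrapT => no; apply: xy; apply/funext => i.
by apply: contrapT => ne; apply: no; exists i.
Qed.

Lemma adjacent_bits x y i j : bit_adjacent (x, y) -> x i <> y i -> x j <> y j -> i = j.
Proof.
move=> [n /= ->]; rewrite /flip.
case: eqP => [-> _|_]; last by rewrite addbF.
by case: eqP => [-> //|_]; rewrite addbF.
Qed.

Lemma nonadjacent_bits (x y : cantor) : x <> y -> ~ bit_adjacent (x, y) ->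
  exists i j, [/\ i <> j, x i <> y i & x j <> y j].
Proof.
move=> /neq_bit[i xyi] nadj.
have /neq_bit[j xyj] : flip i x <> y by move=> e; apply: nadj; exists i.
have ij : i <> j.
  by move=> ij; move: xyj xyi; rewrite -ij /flip eqxx; case: (x i); case: (y i).
exists i, j; split=> //; move: xyj.
by rewrite /flip (_ : j == i = false) ?addbF //; apply/eqP => /esym.
Qed.

Lemma adjacent_irrefl x : ~ bit_adjacent (x, x).
Proof. by move=> [n /= /(congr1 (@^~ n))]; rewrite /flip eqxx; case: (x n). Qed.

Lemma adjacent_flip n x : bit_adjacent (x, flip n x).
Proof. by exists n. Qed.

Lemma nonadjacent_flip2 m n x : m <> n -> ~ bit_adjacent (flip m x, flip n x).
Proof.
move=> mn adj; apply: (mn); apply: (adjacent_bits adj); rewrite /flip eqxx.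
  by rewrite (introF eqP mn); case: (x m).
by rewrite (introF eqP (nesym mn)); case: (x n).
Qed.

Definition pairs_coded := coded_prod cantor_coded cantor_coded.

Lemma agree_bits (x y : cantor) n i : (i < n)%N ->
  agree n (bits x) (bits y) -> y i = x i.
Proof. by move=> i_n /(_ i i_n). Qed.

Lemma neq_equal_pairs_open : open (~` equal_pairs).
Proof.
have [oc _ _] := pairs_coded; apply/oc => -[x y] /neq_bit[i /= xyi].
exists i.+1 => -[x' y'] /agree_pair[/= xx' yy'] /= e; apply: xyi.
by rewrite -(agree_bits (ltnSn i) xx') -(agree_bits (ltnSn i) yy') (e : x' = y').
Qed.

(** Two points that are neither equal nor adjacent differ at two coordinates,
    and this can be seen on finitely many bits. *)
Lemma far_open : open (~` (equal_pairs `|` bit_adjacent)).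
Proof.
have [oc _ _] := pairs_coded; apply/oc => -[x y] /not_orP[ne nadj].
have [i [j [ij xyi xyj]]] := @nonadjacent_bits x y ne nadj.
have li : (i < (maxn i j).+1)%N by rewrite ltnS leq_maxl.
have lj : (j < (maxn i j).+1)%N by rewrite ltnS leq_maxr.
exists (maxn i j).+1 => -[x' y'] /agree_pair[/= xx' yy'].
rewrite -(agree_bits li xx') -(agree_bits li yy') in xyi.
rewrite -(agree_bits lj xx') -(agree_bits lj yy') in xyj.
case=> [e|/adjacent_bits h]; first by apply: xyi; rewrite (e : x' = y').
by apply: ij; exact: h.
Qed.

Lemma equal_pairs_borel : borel equal_pairs.
Proof. exact: closed_borel neq_equal_pairs_open. Qed.

Lemma adjacentC_borel : borel (~` bit_adjacent).
Proof.
rewrite (_ : ~` bit_adjacent = equal_pairs `|` ~` (equal_pairs `|` bit_adjacent)).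
  by apply: borelU; [exact: equal_pairs_borel|exact: open_borel far_open].
apply/seteqP; split=> -[x y]; last first.
  by case=> [e|/not_orP[]//]; rewrite (e : x = y); exact: adjacent_irrefl.
move=> na.
have [e|ne] := pselect (equal_pairs (x, y)); [by left|right].
by case=> [/ne|/na].
Qed.

Lemma cantor_uncountable : ~ countable [set: cantor].
Proof.
move=> c; apply: (@nonmeager_uncountable set0 [::] meager0).
by apply: sub_countable c; exact: subset_card_le.
Qed.

Lemma uncountable_two (T : Type) (W : set T) : ~ countable W ->
  exists x y, [/\ W x, W y & x <> y].
Proof.
move=> ncW; apply: contrapT => no; apply: ncW.
have [[a Wa]|nW] := pselect (exists a, W a).
  apply: (@sub_countable _ _ _ [set a]) (countable1 a).
  apply: subset_card_le => b Wb /=; apply: contrapT => ba.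
  by apply: no; exists b, a.
rewrite (_ : W = set0) ?countable0 // -subset0 => b Wb; apply: nW.
by exists b.
Qed.

Section Classes.
Variable R : realType.

Lemma cantor_zd_polish : zd_polish R cantor.
Proof. exact: coded_zd_polish cantor_coded. Qed.

Lemma pairs_zd_polish : zd_polish R (cantor * cantor)%type.
Proof. exact: coded_zd_polish pairs_coded. Qed.

(** Equality is not potentially open: [open_square] would provide two distinct
    points whose pair lies in it. *)
Lemma equal_pairs_class :
  potential_wadge_class R equal_pairs (wadge_gen R equal_pairs).
Proof.
apply: (closed_potential_class cantor_coded cantor_coded
  neq_equal_pairs_open _).1 => s t _ ps _ pt oE.
have [|W [_ /uncountable_two[x [y [Wx Wy xy]]] hW]] :=
    @open_square R (space_of s) (space_of t) equal_pairs
      (fun x => x) setT ps pt oE cantor_uncountable.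
  by [].
by apply: xy; exact: hW.
Qed.

(** Take a such that neither a nor any flip of a lies in the meager set off
    which the finer topologies agree with the usual one, where flip n a tends
    to a.  In particular adjacency is not potentially closed. *)
Lemma finer_polish_flip (s t : topology_on cantor) :
  finer s -> polish R (space_of s) -> finer t -> polish R (space_of t) ->
  exists a : cantor,
    (forall U : set (space_of s), open U -> U a ->
      exists N, forall n, (N <= n)%N -> U (flip n a)) /\
    (forall U : set (space_of t), open U -> U a ->
      exists N, forall n, (N <= n)%N -> U (flip n a)).
Proof.
move=> fs ps ft pt.
have [M mM hM] := finer_polish_generic fs ps.
have [N mN hN] := finer_polish_generic ft pt.
have mMN := meagerU mM mN.
have mf : meager (\bigcup_n (flip n @^-1` (M `|` N))).
  by apply: meager_bigcup => n; exact: meager_flip.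
have [a _ na] := baire [::] (meagerU mMN mf); exists a.
have [nMN nf] : ~ (M `|` N) a /\ forall n, ~ (M `|` N) (flip n a).
  split=> [h|n h]; first by apply: na; left.
  by apply: na; right; exists n.
split=> U oU Ua.
  have [k hk] := hM U a oU Ua (fun h => nMN (or_introl h)); exists k => n kn.
  apply: hk; first by apply: agreeW kn _; exact: flip_agree.
  by move=> h; apply: (nf n); left.
have [k hk] := hN U a oU Ua (fun h => nMN (or_intror h)); exists k => n kn.
apply: hk; first by apply: agreeW kn _; exact: flip_agree.
by move=> h; apply: (nf n); right.
Qed.

(** Let theta reduce non-adjacency for finer topologies.  With the point a of
    [finer_polish_flip], the ladder formed by theta (a, a), theta (a, flip n a)
    and theta (flip k a, flip n a), with n < k, is in the target set, out of it,
    and in it again, because flip k a and flip n a differ at two coordinates.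
    As equality and its union with adjacency are closed, [ladder] turns it into
    a reduction which is continuous for the usual topology. *)
Lemma nonadjacent_class :
  let Gamma := wadge_gen R (~` bit_adjacent) in
  potential_wadge_class R (~` bit_adjacent) Gamma /\
  forall Gamma', potential_wadge_class R (~` bit_adjacent) Gamma' ->
    pc_sub Gamma' Gamma.
Proof.
apply: (@gen_least R cantor cantor (Topological.class cantor)
  (Topological.class cantor)).
- exact: finer_refl.
- exact: cantor_zd_polish.
- exact: finer_refl.
- exact: cantor_zd_polish.
- exact: pairs_zd_polish.
- exact: adjacentC_borel.
move=> s t P0 A0 theta fs [ps _] ft [pt _] _ /continuousP ct AE.
have [a [sa ta]] := finer_polish_flip fs ps ft pt.
have A0E p : A0 (theta p) <-> ~ bit_adjacent p.
  have -> : (~ bit_adjacent p) = A0 (theta p) by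
    exact: (congr1 (fun S : set (cantor * cantor) => S p) AE).
  by [].
pose z n k := theta (flip (n + k).+1 a, flip n a).
have [psi cpsi hpsi] : exists2 psi : (cantor * cantor)%type -> P0,
    continuous psi & forall p, [/\ ~ ~ equal_pairs p -> psi p = theta (a, a),
      ~ equal_pairs p -> (equal_pairs `|` bit_adjacent) p ->
        exists n, psi p = theta (a, flip n a)
      & ~ equal_pairs p -> ~ (equal_pairs `|` bit_adjacent) p ->
        exists n k : nat, psi p = z n k].
  apply: (ladder pairs_coded neq_equal_pairs_open far_open).
  - move=> O oO Oa.
    have [U [V [oU oV Ua Va UV]]] := (prod_openP _).1 (ct O oO) _ Oa.
    by have [N hN] := ta V oV Va; exists N => n Nn; apply: UV => //; exact: hN.
  - move=> n O oO On.
    have [U [V [oU oV Ua Va UV]]] := (prod_openP _).1 (ct O oO) _ On.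
    have [N hN] := sa U oU Ua; exists N => k Nk; apply: UV => //; apply: hN.
    by rewrite leqW // (leq_trans Nk) // leq_addl.
  - move=> O oO Oa.
    have [U [V [oU oV Ua Va UV]]] := (prod_openP _).1 (ct O oO) _ Oa.
    have [N hN] := sa U oU Ua; have [N' hN'] := ta V oV Va.
    exists (maxn N N') => n k Nn _; apply: UV; [apply: hN|apply: hN'].
      by rewrite leqW // (leq_trans _ (leq_addr _ _)) // (leq_trans _ Nn) // leq_maxl.
    by rewrite (leq_trans _ Nn) // leq_maxr.
exists psi => //; apply/seteqP; split=> p; have [h1 h2 h3] := hpsi p.
  move=> np; rewrite /preimage /=.
  have [e|ne] := pselect (equal_pairs p).
    by rewrite h1 => [|/(_ e)//]; apply/A0E; exact: adjacent_irrefl.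
  have [|n [k ->]] := h3 ne; first by case=> [/ne|/np].
  by apply/A0E; apply: nonadjacent_flip2 => e; have := leq_addr k n;
    rewrite -[X in (X <= _)%N]e ltnn.
rewrite /preimage /= => Ap adjp.
have ne : ~ equal_pairs p.
  by case: p adjp {h1 h2 h3 Ap} => x y adj e; move: adj; rewrite (e : x = y);
    exact: adjacent_irrefl.
have [|n E] := h2 ne; first by right.
by move: Ap; rewrite E => /A0E; apply; exact: adjacent_flip.
Qed.

Lemma equal_pairs_le :
  potential_wadge_class_le R equal_pairs (~` bit_adjacent).
Proof.
exists (wadge_gen R equal_pairs), (wadge_gen R (~` bit_adjacent)); split.
- exact: equal_pairs_class.
- exact: nonadjacent_class.1.
have [psi cpsi psiE] : exists2 psi : (cantor * cantor)%type -> (cantor * cantor)%type,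
    continuous psi & equal_pairs = psi @^-1` (~` bit_adjacent).
  apply: (@closed_reduces R _ _ _ _ _ _ pairs_coded neq_equal_pairs_open).
    by have [] := pairs_zd_polish.
  move=> oA; have [oc _ _] := pairs_coded.
  pose a : cantor := fun=> false.
  have [n hn] := (oc _).1 oA (a, a) (@adjacent_irrefl a).
  apply: (hn (a, flip n a)); last exact: adjacent_flip.
  by apply/agree_pair; split=> //; exact: flip_agree.
exact: wadge_gen_sub cpsi psiE.
Qed.

End Classes.

(** * Inverse images of closed rectangles *)

(** The value of rho outside E is one plus the length needed to leave E, so
    that rho tends to infinity on approaching E: the graph of rho is closed. *)
Lemma closed_height (E : set cantor) : open (~` E) ->
  exists rho : cantor -> nat, (forall x, rho x = 0%N <-> E x) /\
    forall x m, (forall n, exists y, agree n (bits x) (bits y) /\ rho y = m) ->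
      rho x = m.
Proof.
move=> oE; have [r hr] := code_rank cantor_coded oE.
pose rho x := if pselect (E x) then 0%N else (r x).+1.
have rhoE x : E x -> rho x = 0%N by rewrite /rho; case: pselect.
have rhoN x : ~ E x -> rho x = (r x).+1 by rewrite /rho; case: pselect.
exists rho; split=> [x|x m h].
  by rewrite /rho; case: pselect.
have [Ex|nEx] := pselect (E x); last first.
  have [r1 r2 _] := hr x nEx; have [y [xy <-]] := h (r x).
  by rewrite !rhoN ?(r2 y) //; exact: r1.
case: m h => [|m] h; first exact: rhoE.
have [y [xy ym]] := h m.+1.
have nEy : ~ E y by move=> Ey; rewrite rhoE in ym.
have [_ _ /(_ x _ (agreeC xy))] := hr y nEy.
by rewrite rhoN // in ym; case: ym => -> /(_ (fun h => h Ex)); rewrite ltnNge leqnSn.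
Qed.

Definition height_code (rho : cantor -> nat) (x : cantor) (n : nat) :=
  (x n, rho x).

Lemma agree_height rho n x y :
  agree n (height_code rho x) (height_code rho y) -> agree n (bits x) (bits y).
Proof. by move=> a i /a[]. Qed.

Lemma height_coded rho :
  (forall x m, (forall n, exists y, agree n (bits x) (bits y) /\ rho y = m) ->
     rho x = m) ->
  coded (height_code rho : code_space (height_code rho) -> _).
Proof.
have [_ ic _] := cantor_coded.
move=> hrho; apply: code_space_coded => [x y xy|u hu].
  by apply: ic => n; apply: agree_height (xy n).
pose x : cantor := fun n => (u n).1; exists x.
have hx n y : agree n (height_code rho y) u -> agree n (bits x) (bits y).
  by move=> a i /a; rewrite /x /bits => <-.
have rhox i : rho x = (u i).2.
  apply: hrho => n; have [y hy] := hu (maxn n i.+1); exists y.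
  split; first by apply: hx; apply: agreeW hy; exact: leq_maxl.
  by have := hy i; rewrite leq_max ltnSn orbT => /(_ isT) <-.
by move=> n i _; rewrite /height_code (rhox i); rewrite /x -surjective_pairing.
Qed.

(** Adding a height function with closed graph to the code keeps the range
    closed, and E, the zero set of the height, becomes clopen. *)
Lemma closed_clopen (R : realType) (E : set cantor) : open (~` E) ->
  exists sigma : topology_on cantor, [/\ finer sigma, zd_polish R (space_of sigma),
    exists V : countType, exists c : space_of sigma -> nat -> V, coded c,
    open (E : set (space_of sigma)) & open (~` E : set (space_of sigma))].
Proof.
move=> oE; have [rho [rho0 hrho]] := closed_height oE.
have cc := height_coded hrho; have [oc _ _] := cc.
have [oK _ _] := cantor_coded.
exists (Topological.class (code_space (height_code rho))); split.
- move=> U /oK oU; apply/oc => x /oU[n hn].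
  by exists n => y /agree_height/hn.
- exact: (@coded_zd_polish R (code_space (height_code rho)) _ _ cc).
- by exists _, (height_code rho).
- apply/oc => x Ex; exists 1%N => y /(_ 0%N isT)[_ e].
  by apply/rho0; rewrite -e; apply/rho0.
- apply/oc => x nEx; exists 1%N => y /(_ 0%N isT)[_ e] Ey; apply: nEx.
  by apply/rho0; rewrite e; apply/rho0.
Qed.

Lemma open_setX (X Y : topologicalType) (U : set X) (V : set Y) :
  open U -> open V -> open (U `*` V).
Proof. by move=> oU oV; apply/prod_openP => -[x y] [/= Ux Vy]; exists U, V. Qed.

Lemma open_setXC (X Y : topologicalType) (U : set X) (V : set Y) :
  open (~` U) -> open (~` V) -> open (~` (U `*` V)).
Proof.
move=> oU oV; apply/prod_openP => -[x y] /not_andP[/= nU|/= nV].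
  exists (~` U), setT; split=> //; first exact: openT.
  by move=> x' y' nU' _ [].
exists setT, (~` V); split=> //; first exact: openT.
by move=> x' y' _ nV' [].
Qed.

Lemma clopen_if_continuous (P P0 : topologicalType) (D : set P) (a b : P0) :
  open D -> open (~` D) -> continuous (fun z => if pselect (D z) then a else b).
Proof.
move=> oD oD'; apply/continuousP => O oO; rewrite openE => z; rewrite /preimage /=.
case: pselect => Dz Oz.
  apply: filterS (open_nbhs_nbhs (conj oD Dz)) => w Dw /=.
  by case: pselect.
apply: filterS (open_nbhs_nbhs (conj oD' Dz)) => w Dw /=.
by case: pselect.
Qed.

(** A rectangle with closed sides is clopen for suitable finer topologies;
    a reduction of a non-trivial clopen set need only take two values, so its
    potential class consists of clopen sets. *)
Lemma rectangle_class (R : realType) (E E' : set cantor) (p q : cantor * cantor) :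
  open (~` E) -> open (~` E') -> (E `*` E') p -> ~ (E `*` E') q ->
  forall Gamma, potential_wadge_class R (E `*` E') Gamma ->
    forall (P : topologicalType) (A : set P), Gamma P A -> open A.
Proof.
move=> oE oE' Ep nEq.
have [s [fs zs [V [c cs]] os os']] := closed_clopen R oE.
have [t [ft zt [W [d ct]] ot ot']] := closed_clopen R oE'.
have oEE : open (E `*` E' : set (space_of s * space_of t)).
  by apply: (@open_setX (space_of s) (space_of t)).
have oEEC : open (~` (E `*` E') : set (space_of s * space_of t)).
  by apply: (@open_setXC (space_of s) (space_of t)).
have [|_ least] := @gen_least R cantor cantor s t (E `*` E') fs zs ft zt
    (coded_zd_polish R (coded_prod cs ct)) (open_borel oEE).
  move=> s' t' P0 A0 theta _ _ _ _ _ _ AE.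
  have tp : A0 (theta p) by have := Ep; rewrite AE.
  have tq : ~ A0 (theta q) by have := nEq; rewrite AE.
  exists (fun z => if pselect ((E `*` E') z) then theta p else theta q).
    exact: clopen_if_continuous.
  by apply/seteqP; split=> z; rewrite /preimage /=; case: pselect.
move=> Gamma /least sub P A /sub[_ _ [f /continuousP cf ->]].
exact: cf.
Qed.

(** A function f of the class witnesses an inclusion between potential classes
    for every Borel target, not only for the one it was obtained from. *)
Lemma characterizes_open (R : realType) (C : top_fun_class) :
  characterizes_inclusion R C ->
  forall f : cantor * cantor -> cantor * cantor, C cantor cantor cantor cantor f ->
    borel_fun f ->
  forall E E' : set cantor, open (~` E) -> open (~` E') ->
  exists s t : topology_on cantor,
    [/\ finer s, polish R (space_of s), finer t, polish R (space_of t)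
      & open (f @^-1` (E `*` E') : set (space_of s * space_of t))].
Proof.
move=> charC f Cf bf E E' oE oE'.
have [pK _] := cantor_zd_polish R.
have [[p Ep]|noE] := pselect (exists p, (E `*` E') p); last first.
  exists (Topological.class cantor), (Topological.class cantor); split=> //.
  rewrite (_ : f @^-1` _ = set0); first exact: open0.
  by rewrite -subset0 => z Ez; apply: noE; exists (f z).
have [[q nEq]|allE] := pselect (exists q, ~ (E `*` E') q); last first.
  exists (Topological.class cantor), (Topological.class cantor); split=> //.
  rewrite (_ : f @^-1` _ = setT); first exact: openT.
  by rewrite -subTset => z _; apply: contrapT => nz; apply: allE; exists (f z).
have bE : borel (E `*` E') by apply: closed_borel; exact: open_setXC.
have /(charC _ _ _ _ pK pK pK pK _ _ (bf _ bE) bE)[GA [GB [[_ pA _] pB sub]]] :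
    exists g, C cantor cantor cantor cantor g /\
      f @^-1` (E `*` E') = g @^-1` (E `*` E').
  by exists f.
have [s [t [[fs [ps _]] [ft [pt _]] /sub GBA]]] := pA.
exists s, t; split=> //.
exact: (rectangle_class oE oE' Ep nEq pB GBA).
Qed.

(** * Perfect sets of values without adjacent points *)

Section PerfectImage.
Variables (M : set cantor) (g : cantor -> cantor).
Hypothesis g_cont : forall x m, ~ M x ->
  exists n, forall y, agree n x y -> ~ M y -> agree m (g x) (g y).
Hypothesis g_nonconst : forall s, exists x y,
  [/\ cyl s x, cyl s y, ~ M x, ~ M y & g x <> g y].

(** Below s, near x, the values of g can be fixed on the first m bits while
    avoiding a nowhere dense set. *)
Lemma settle (N : set cantor) s x m : nowhere_dense N -> cyl s x -> ~ M x ->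
  exists t, [/\ (size s < size (s ++ t))%N, forall y, cyl (s ++ t) y -> ~ N y
    & forall y, cyl (s ++ t) y -> ~ M y -> agree m (g x) (g y)].
Proof.
move=> hN sx nMx; have [n hn] := g_cont m nMx.
have sl : (size s <= (maxn n (size s)).+1)%N by rewrite leqW // leq_maxr.
have [t xE] := cyl_prefix sx sl; have [u hu] := hN (s ++ t).
exists (t ++ u); rewrite catA; split=> //.
  by rewrite size_cat -xE size_mkseq addSn ltnS (leq_trans (leq_maxr n _)) // leq_addr.
move=> y /cyl_cat; rewrite -xE => /cyl_mkseq xy; apply: hn; apply: agreeW xy.
by rewrite leqW // leq_maxl.
Qed.

(** Take two values that differ at a bit i.  Near the first one the bit i is
    fixed, and two of the values there differ at a further bit j; one of these
    two also differs at j from the second value. *)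
Lemma split_two_bits s : exists x y i j,
  [/\ cyl s x /\ cyl s y, ~ M x /\ ~ M y, i <> j, g x i <> g y i & g x j <> g y j].
Proof.
have [x [y [sx sy Mx My /neq_bit[i gi]]]] := g_nonconst s.
have h0 : nowhere_dense set0 by move=> u; exists [::] => z _ [].
have [t [_ _ ht]] := settle i.+1 h0 sx Mx.
have [x1 [x2 [tx1 tx2 Mx1 Mx2 /neq_bit[j gj]]]] := g_nonconst (s ++ t).
have e1 := ht _ tx1 Mx1 i (ltnSn i); have e2 := ht _ tx2 Mx2 i (ltnSn i).
have ij : i <> j by move=> ij; apply: gj; rewrite -ij -e1 -e2.
have [e|ne] := pselect (g x1 j = g y j).
  exists x2, y, i, j; split=> //; [|by rewrite -e2|by rewrite -e => /esym].
  by split=> //; exact: cyl_cat tx2.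
exists x1, y, i, j; split=> //; last by rewrite -e1.
by split=> //; exact: cyl_cat tx1.
Qed.

(** One step of a perfect tree: on the two sons of s the values of g take
    opposite constant values at two coordinates q.1.2. *)
Lemma split_node (N : set cantor) s : nowhere_dense N ->
  exists q : (bool -> seq bool) * (nat * nat) * (bool * bool),
  [/\ forall b, exists t, q.1.1 b = s ++ t,
      forall b, (size s < size (q.1.1 b))%N,
      forall b y, cyl (q.1.1 b) y -> ~ N y,
      q.1.2.1 <> q.1.2.2
    & forall b y, cyl (q.1.1 b) y -> ~ M y ->
        g y q.1.2.1 = b (+) q.2.1 /\ g y q.1.2.2 = b (+) q.2.2].
Proof.
move=> hN; have [x [y [i [j [[sx sy] [Mx My] ij gi gj]]]]] := split_two_bits s.
have [t [t1 t2 t3]] := settle (maxn i j).+1 hN sx Mx.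
have [u [u1 u2 u3]] := settle (maxn i j).+1 hN sy My.
exists (fun b => s ++ if b then u else t, (i, j), (g x i, g x j)) => /=.
have li : (i < (maxn i j).+1)%N by rewrite ltnS leq_maxl.
have lj : (j < (maxn i j).+1)%N by rewrite ltnS leq_maxr.
split=> //.
- by move=> b; eexists.
- by case.
- by case.
case=> z hz nMz.
  rewrite -(u3 z hz nMz i li) -(u3 z hz nMz j lj).
  by move: gi gj; case: (g x i); case: (g y i); case: (g x j); case: (g y j).
by rewrite -(t3 z hz nMz i li) -(t3 z hz nMz j lj).
Qed.

(** The first n bits, latest first, so that the tree of nodes can be defined
    by recursion on the history. *)
Fixpoint history (alpha : nat -> bool) (n : nat) : seq bool :=
  if n is m.+1 then alpha m :: history alpha m else [::].

Lemma size_history alpha n : size (history alpha n) = n.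
Proof. by elim: n => //= n ->. Qed.

Lemma agree_history alpha beta n :
  agree n alpha beta -> history alpha n = history beta n.
Proof.
elim: n => //= n IH a; rewrite a // IH // => i i_n.
by apply: a; apply: ltnW.
Qed.

(** E is the image under g of the branches of a perfect tree of nodes.  Two
    branches that split take values which differ at two coordinates, hence are
    not adjacent.  E is closed because a limit of values determines a branch:
    at each node the bit I of the value tells which son to take. *)
Lemma perfect_image : meager M -> exists E : set cantor,
  [/\ open (~` E), forall e e', E e -> E e' -> ~ bit_adjacent (e, e')
    & ~ countable [set x | ~ M x /\ E (g x)]].
Proof.
move=> [N [hN MN]].
have /choice[Q hQ] := fun p : nat * seq bool => split_node p.2 (hN p.1).
pose node := fix node (u : seq bool) : seq bool :=
  if u is b :: u' then (Q (size u', node u')).1.1 b else [::].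
pose I u := (Q (size u, node u)).1.2.1; pose J u := (Q (size u, node u)).1.2.2.
pose v u := (Q (size u, node u)).2.1; pose v' u := (Q (size u, node u)).2.2.
pose p alpha : cantor := fun i => nth false (node (history alpha i.+1)) i.
have szn alpha n : (n <= size (node (history alpha n)))%N.
  elim: n => //= n IH; apply: leq_ltn_trans IH _.
  by have [_ /(_ (alpha n))] := hQ (size (history alpha n), node (history alpha n)).
have cp alpha n : cyl (node (history alpha n)) (p alpha).
  apply: (cyl_chain (w := fun n => node (history alpha n))) => // m /=.
  by have [/(_ (alpha m))] := hQ (size (history alpha m), node (history alpha m)).
have Mp alpha : ~ M (p alpha).
  move=> /MN[n _]; have := cp alpha n.+1; rewrite /= size_history.
  by have [_ _ + _ _] := hQ (n, node (history alpha n)); apply.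
have gp alpha n (u := history alpha n) :
    g (p alpha) (I u) = alpha n (+) v u /\ g (p alpha) (J u) = alpha n (+) v' u.
  have [_ _ _ _ /(_ (alpha n) (p alpha))] := hQ (size u, node u).
  by apply; [exact: (cp alpha n.+1)|exact: Mp].
have IJ u : I u <> J u by have [_ _ _] := hQ (size u, node u).
have split_hist alpha beta : alpha <> beta -> exists u,
    g (p alpha) (I u) <> g (p beta) (I u) /\ g (p alpha) (J u) <> g (p beta) (J u).
  move=> ab; have ex : exists n, alpha n != beta n.
    by have [n /eqP] := @neq_bit alpha beta ab; exists n.
  case: (ex_minnP ex) => n ne nmin.
  have hist : history alpha n = history beta n.
    apply: agree_history => i i_n; apply/eqP/negPn/negP => /nmin.
    by rewrite leqNgt i_n.
  exists (history alpha n); have [-> ->] := gp alpha n.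
  rewrite hist; have [-> ->] := gp beta n; move: ne.
  by case: (alpha n); case: (beta n); case: (v _); case: (v' _).
pose E : set cantor := [set e | exists alpha, e = g (p alpha)].
exists E; split.
- have [oc _ _] := cantor_coded; apply/oc => e nEe.
  apply: contrapT => no; apply: nEe.
  have /choice[beta hbeta] : forall n, exists beta, agree n e (g (p beta)).
    move=> n; apply: contrapT => nb; apply: no; exists n => e' ee' [beta e'E].
    by apply: nb; exists beta; rewrite -e'E.
  (* At each node the bit I of e tells which branch alpha has to take. *)
  pose h := fix h n := if n is m.+1 then (e (I (h m)) (+) v (h m)) :: h m else [::].
  pose alpha n := e (I (h n)) (+) v (h n).
  have hE n : history alpha n = h n by elim: n => //= n ->.
  exists alpha; apply/funext => k; have [n hn] := g_cont k.+1 (Mp alpha).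
  (* m is beyond k and all the bits consulted at the first n nodes. *)
  pose m := maxn k.+1 (\max_(l < n) (I (h l)).+1).
  have hm l : (l < n)%N -> (I (h l) < m)%N.
    move=> ln; apply: leq_trans (leq_maxr _ _).
    exact: (leq_bigmax (Ordinal ln) (F := fun l : 'I_n => (I (h l)).+1)).
  have hist l : (l <= n)%N -> history (beta m) l = h l.
    elim: l => //= l IH ln; rewrite IH ?(ltnW ln) //; congr cons.
    have [+ _] := gp (beta m) l; rewrite IH ?(ltnW ln) // -(hbeta m) ?hm // => ->.
    by rewrite -addbA addbb addbF.
  rewrite (hbeta m k) ?leq_maxl //; apply/esym; apply: hn (Mp _) _ (ltnSn k).
  have ca := cp alpha n; have cb := cp (beta m) n; rewrite hE in ca.
  rewrite hist // in cb; move=> i i_n; have := szn alpha n; rewrite hE => sz.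
  by rewrite -ca ?cb //; exact: leq_trans sz.
- move=> _ _ [alpha ->] [beta ->] adj.
  have [ab|ab] := pselect (alpha = beta).
    by rewrite ab in adj; exact: adjacent_irrefl adj.
  have [u [nI nJ]] := split_hist _ _ ab.
  exact: (IJ u (adjacent_bits adj nI nJ)).
- move=> /countable_injP[f finj]; apply: cantor_uncountable.
  apply/countable_injP; exists (fun alpha => f (p alpha)) => alpha beta _ _ e.
  have pe : p alpha = p beta.
    apply: finj => //; rewrite inE; split; [exact: Mp| |exact: Mp|].
      by exists alpha.
    by exists beta.
  apply: contrapT => /split_hist[u [+ _]]; apply.
  by rewrite pe.
Qed.

End PerfectImage.

(** * The Borel case *)

Lemma cyl_closed s : open (~` cyl s).
Proof.
have [oc _ _] := cantor_coded; apply/oc => x nx; exists (size s) => y xy sy.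
by apply: nx; exact: agree_trans sy (agreeC xy).
Qed.

Lemma point_closed (a : cantor) : open (~` [set a]).
Proof.
have [oc _ _] := cantor_coded; apply/oc => x /neq_bit[i xi]; exists i.+1 => y xy.
by move=> /= ya; apply: xi; rewrite -ya (agree_bits (ltnSn i) xy).
Qed.

(** Off a meager set f maps the diagonal into itself.  Otherwise f (a, a)
    consists of two points that differ at two coordinates, as they are not
    adjacent; then so does f (x, a) for generic x close to a, although f (x, a)
    is an adjacent pair.  The first coordinate g of f on the diagonal is
    generically continuous, and a closed set E without adjacent points pulls
    E * E back into the diagonal, so that g can take only countably many times
    values in E. *)
Lemma no_rectangular_reduction (R : realType)
    (f : cantor * cantor -> cantor * cantor) :
  equal_pairs = f @^-1` (~` bit_adjacent) ->
  (forall E E' : set cantor, open (~` E) -> open (~` E') ->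
    exists s t : topology_on cantor,
    [/\ finer s, polish R (space_of s), finer t, polish R (space_of t)
      & open (f @^-1` (E `*` E') : set (space_of s * space_of t))]) ->
  False.
Proof.
move=> fE hf.
have f_diag a : ~ bit_adjacent (f (a, a)).
  have : equal_pairs (a, a) by [].
  by rewrite fE.
have f_off x y : x <> y -> bit_adjacent (f (x, y)).
  move=> xy; apply: contrapT => nadj; apply: xy.
  suff : equal_pairs (x, y) by [].
  by rewrite fE.
have [M mM hM] : exists2 M, meager M & forall a m, ~ M a -> exists n,
    forall x y, agree n a x -> agree n a y -> ~ M x -> ~ M y ->
      agree m (f (a, a)).1 (f (x, y)).1 /\ agree m (f (a, a)).2 (f (x, y)).2.
  have /choice[N hN] : forall p : seq bool * seq bool, exists M, meager M /\
      forall a, ~ M a -> (cyl p.1 `*` cyl p.2) (f (a, a)) -> exists n,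
        forall x y, agree n a x -> agree n a y -> ~ M x -> ~ M y ->
          (cyl p.1 `*` cyl p.2) (f (x, y)).
    move=> p; have [s [t [fs ps ft pt oO]]] :=
      hf _ _ (@cyl_closed p.1) (@cyl_closed p.2).
    by have [M mM hM] := pot_open_generic fs ps ft pt oO; exists M.
  exists (\bigcup_p N p); first by apply: meager_bigcup => p; have [] := hN p.
  move=> a m na; pose p := (mkseq (f (a, a)).1 m, mkseq (f (a, a)).2 m).
  have out z : ~ (\bigcup_p N p) z -> ~ N p z by move=> nz Nz; apply: nz; exists p.
  have [_ /(_ a (out _ na))[]] := hN p; first by split; apply/cyl_mkseq.
  move=> n hn; exists n => x y ax ay nx ny.
  by have [/cyl_mkseq ? /cyl_mkseq ?] := hn x y ax ay (out _ nx) (out _ ny).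
pose g a := (f (a, a)).1.
have f_diagE a : ~ M a -> f (a, a) = (g a, g a).
  move=> na; rewrite [LHS]surjective_pairing; congr pair; apply/esym.
  apply: contrapT => ne; have := f_diag a; rewrite [f _]surjective_pairing.
  move=> /(nonadjacent_bits ne)[i [j [ij ni nj]]].
  have [n hn] := hM a (maxn i j).+1 na.
  have [x /cyl_mkseq ax /not_orP[nx xa]] :=
    baire (mkseq a n) (meagerU mM (meager1 a)).
  have [h1 h2] := hn x a ax (fun _ _ => erefl) nx na.
  have := f_off x a xa; rewrite [f (x, a)]surjective_pairing => adj.
  by apply: ij; apply: (adjacent_bits adj); rewrite -h1 -?h2 ?ltnS ?leq_maxl ?leq_maxr.
have kill (E : set cantor) : open (~` E) ->
    (forall e e', E e -> E e' -> ~ bit_adjacent (e, e')) ->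
    countable [set x | ~ M x /\ E (g x)].
  move=> oE Eind; apply: contrapT => nc.
  have [s [t [fs ps ft pt oO]]] := hf E E oE oE.
  have [|W [_ /uncountable_two[x [y [Wx Wy xy]]] hW]] :=
    @open_square R (space_of s) (space_of t) _ (fun x => x) _ ps pt oO nc.
    by move=> x [nx Ex]; rewrite /preimage /= f_diagE.
  have [/= Ex Ey] := hW x y Wx Wy.
  by have := f_off x y xy; rewrite [f _]surjective_pairing; exact: Eind.
have g_cont x m : ~ M x ->
    exists n, forall y, agree n x y -> ~ M y -> agree m (g x) (g y).
  move=> nx; have [n hn] := hM x m nx; exists n => y xy ny.
  by have [] := hn y y xy xy ny ny.
have g_nonconst s : exists x y, [/\ cyl s x, cyl s y, ~ M x, ~ M y & g x <> g y].
  apply: contrapT => no; have [a sa na] := baire s mM.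
  apply: (@nonmeager_uncountable M s mM).
  have := kill [set g a] (@point_closed _).
  have ind e e' : [set g a] e -> [set g a] e' -> ~ bit_adjacent (e, e').
    by move=> -> ->; exact: adjacent_irrefl.
  move=> /(_ ind); apply: sub_countable; apply: subset_card_le => x [sx nx].
  split=> //=; apply: contrapT => ne; apply: no; exists x, a; split=> //.
have [E [oE Eind nc]] := perfect_image g_cont g_nonconst mM.
exact: nc (kill E oE Eind).
Qed.

(** Equality lies below non-adjacency for the inclusion of potential classes,
    but no Borel function of the class can witness it. *)
Theorem no_borel_class (R : realType) (C : top_fun_class) :
  borel_fun_class R C -> ~ characterizes_inclusion R C.
Proof.
move=> bC charC; have [pK _] := cantor_zd_polish R.
have [f [Cf fE]] := (charC _ _ _ _ pK pK pK pK _ _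
  equal_pairs_borel adjacentC_borel).1 (equal_pairs_le R).
have bf := bC _ _ _ _ pK pK pK pK f Cf.
exact: (no_rectangular_reduction fE (characterizes_open charC Cf bf)).
Qed.

(** * A topology in which adjacency is closed *)

Definition bit_xor (x y : nat -> bool) : nat -> bool := fun i => x i (+) y i.

Lemma bit_xorK x y : bit_xor (bit_xor x y) y = x.
Proof. by apply/funext => i; rewrite /bit_xor -addbA addbb addbF. Qed.

Definition ev_eq (x y : nat -> bool) : Prop :=
  exists N, forall n, (N <= n)%N -> x n = y n.

Lemma ev_eqC x y : ev_eq x y -> ev_eq y x.
Proof. by move=> [N h]; exists N => n /h. Qed.

Lemma ev_eq_trans x y z : ev_eq x y -> ev_eq y z -> ev_eq x z.
Proof.
move=> [M hM] [N hN]; exists (maxn M N) => n; rewrite geq_max => /andP[Mn Nn].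
by rewrite hM // hN.
Qed.

Lemma ev_eq_flip n x : ev_eq x (flip n x).
Proof.
by exists n.+1 => i ni; rewrite /flip gtn_eqF ?addbF.
Qed.

(** A choice of one point in each class of eventual equality. *)
Definition ev_rep (x : nat -> bool) : nat -> bool :=
  xget (fun=> false) [set y | ev_eq x y].

Lemma ev_rep_eq x : ev_eq x (ev_rep x).
Proof. by apply: (@xgetPex _ _ [set y | ev_eq x y]); exists x, 0%N. Qed.

Lemma ev_repP x y : ev_eq x y -> ev_rep x = ev_rep y.
Proof.
move=> xy; rewrite /ev_rep; congr xget; apply/seteqP; split=> z /= h.
  by apply: ev_eq_trans h; exact: ev_eqC.
exact: ev_eq_trans h.
Qed.

Lemma ev_rep_id x : ev_rep (ev_rep x) = ev_rep x.
Proof. by apply/esym/ev_repP/ev_rep_eq. Qed.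

(** Each bit of x is repeated infinitely often, so that distinct points are
    sent to distinct classes of eventual equality. *)
Definition spread (x : nat -> bool) : nat -> bool := fun n => x (logn 2 n).

Lemma spread_inj x y : ev_eq (spread x) (spread y) -> x = y.
Proof.
move=> [N h]; apply/funext => i; have := h (2 ^ i * N.*2.+1)%N.
rewrite /spread lognM ?expn_gt0 // pfactorK // logn_coprime ?addn0 //; last first.
  by rewrite coprime2n /= odd_double.
apply; apply: leq_trans (leq_pmull _ _); last by rewrite expn_gt0.
by rewrite leqW // -addnn leq_addr.
Qed.

(** Only the values of b on the representatives matter: there b is a bijection
    onto the Cantor space. *)
Lemma ev_rep_bijection : exists b : (nat -> bool) -> (nat -> bool),
  (forall x y, b (ev_rep x) = b (ev_rep y) -> ev_rep x = ev_rep y) /\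
  (forall z, exists x, b (ev_rep x) = z).
Proof.
have : (range ev_rep #= [set: nat -> bool])%card.
  apply: Cantor_Bernstein; first exact: subset_card_le.
  have inj : {in [set: nat -> bool] &, injective (ev_rep \o spread)}.
    move=> x y _ _ /= e; apply: spread_inj.
    apply: ev_eq_trans (ev_rep_eq _) _; rewrite e.
    exact: ev_eqC (ev_rep_eq _).
  rewrite -(card_le_eql (inj_card_eq inj)).
  by apply: subset_card_le => _ [x _ <-]; exists (spread x).
move=> /card_set_bijP[b [_ binj bsurj]]; exists b; split.
  move=> x y; apply: binj; rewrite inE; first by exists x.
  by exists y.
by move=> z; have [_ [x _ <-] <-] := bsurj z I; exists x.
Qed.

Definition fin_code (z : nat -> bool) : seq bool :=
  xget [::] [set l | nth false l = z].

Lemma fin_codeK z : ev_eq z (fun=> false) -> nth false (fin_code z) = z.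
Proof.
move=> [N h]; apply: (@xgetPex _ _ [set l | nth false l = z]).
exists (mkseq z N); apply/funext => i; case: (ltnP i N) => Ni.
  by rewrite nth_mkseq.
by rewrite nth_default ?size_mkseq // h.
Qed.

Definition rep_diff x := bit_xor x (ev_rep x).

Lemma rep_diff_fin x : ev_eq (rep_diff x) (fun=> false).
Proof.
have [N h] := ev_rep_eq x; exists N => n Nn.
by rewrite /rep_diff /bit_xor -h // addbb.
Qed.

Lemma rep_diffK x : bit_xor (rep_diff x) (ev_rep x) = x.
Proof. exact: bit_xorK. Qed.

Section SmoothTopology.
Variable b : (nat -> bool) -> (nat -> bool).
Hypothesis b_inj : forall x y, b (ev_rep x) = b (ev_rep y) -> ev_rep x = ev_rep y.
Hypothesis b_surj : forall z, exists x, b (ev_rep x) = z.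

(** A point is coded by its class, as a point of the Cantor space, and by its
    finite difference to the representative of the class, as a discrete
    datum. *)
Definition smooth_code (x : nat -> bool) (n : nat) : bool * seq bool :=
  (b (ev_rep x) n, fin_code (rep_diff x)).

Definition smooth_cantor : topologicalType := code_space smooth_code.

Lemma smooth_code_eq x y n : agree n.+1 (smooth_code x) (smooth_code y) ->
  rep_diff x = rep_diff y.
Proof.
move=> /(_ 0%N isT)[_ /(congr1 (nth false))].
by rewrite !fin_codeK //; exact: rep_diff_fin.
Qed.

Lemma smooth_coded : coded (smooth_code : smooth_cantor -> _).
Proof.
apply: code_space_coded => [x y xy|u hu].
  have e1 : ev_rep x = ev_rep y.
    by apply: b_inj; apply/funext => n; have [] := xy n.+1 n (ltnSn n).
  by rewrite -(rep_diffK x) -(rep_diffK y) e1 (smooth_code_eq (xy 1%N)).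
have [x1 h1] := hu 1%N; have [t bt] := b_surj (fun n => (u n).1).
exists (bit_xor (ev_rep t) (rep_diff x1)).
have e1 : ev_rep (bit_xor (ev_rep t) (rep_diff x1)) = ev_rep t.
  rewrite -[RHS]ev_rep_id; apply: ev_repP; have [N h] := rep_diff_fin x1.
  by exists N => n Nn; rewrite /bit_xor h // addbF.
have e2 : rep_diff (bit_xor (ev_rep t) (rep_diff x1)) = rep_diff x1.
  rewrite {1}/rep_diff e1; apply/funext => i; rewrite /bit_xor addbC.
  by rewrite addbA addbb.
move=> n i _; rewrite /smooth_code e1 e2 bt [RHS]surjective_pairing; congr pair.
have [x hx] := hu i.+1; rewrite -(hx i (ltnSn i)) /=.
by have := h1 0%N isT; rewrite -(hx 0%N isT) => -[_].
Qed.

Definition smooth_pairs_coded := coded_prod smooth_coded smooth_coded.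

Lemma ev_rep_adjacent x y : bit_adjacent (x, y) -> ev_rep x = ev_rep y.
Proof. by move=> [n /= ->]; apply: ev_repP; exact: ev_eq_flip. Qed.

(** Adjacency says that the classes are equal, which is a closed condition, and
    it relates the discrete data by a clopen condition. *)
Lemma adjacent_smooth_closed :
  open (~` bit_adjacent : set (smooth_cantor * smooth_cantor)).
Proof.
have [oc _ _] := smooth_pairs_coded; apply/oc => -[x y] nadj.
have [e|ne] := pselect (ev_rep x = ev_rep y); last first.
  have /neq_bit[n bn] : b (ev_rep x) <> b (ev_rep y) by move/b_inj.
  exists n.+1 => -[x' y'] /agree_pair[/= xx' yy'] /ev_rep_adjacent e; apply: bn.
  have [-> _] := xx' n (ltnSn n); have [-> _] := yy' n (ltnSn n).
  by rewrite e.
exists 1%N => -[x' y'] /agree_pair[/= /smooth_code_eq xx' /smooth_code_eq yy'] adj.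
apply: nadj; have e' := ev_rep_adjacent adj; have [n /= yE] := adj; exists n => /=.
have yE2 : y = bit_xor (rep_diff y') (ev_rep x) by rewrite -yy' e rep_diffK.
have xE : x = bit_xor (rep_diff x') (ev_rep x) by rewrite -xx' rep_diffK.
apply/funext => i; rewrite yE2 /flip [x in RHS]xE /bit_xor /rep_diff -e' yE.
rewrite /bit_xor /flip.
by case: (x' i); case: (ev_rep x' i); case: (ev_rep x i); case: (i == n).
Qed.

(** Adjacency is not potentially open: it has countable sections, whereas
    [open_square] would give an uncountable one. *)
Lemma adjacent_smooth_class (R : realType) :
  let Gamma := wadge_gen R
    (bit_adjacent : set (smooth_cantor * smooth_cantor)) in
  potential_wadge_class R
    (bit_adjacent : set (smooth_cantor * smooth_cantor)) Gamma /\
  forall Gamma', potential_wadge_class R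
    (bit_adjacent : set (smooth_cantor * smooth_cantor)) Gamma' ->
    pc_sub Gamma' Gamma.
Proof.
apply: (closed_potential_class smooth_coded smooth_coded adjacent_smooth_closed).
move=> s t _ ps _ pt oE.
have [|W [_ ncW hW]] :=
    @open_square R (space_of s) (space_of t) bit_adjacent (flip 0) setT
      ps pt oE cantor_uncountable.
  by move=> x _; exact: adjacent_flip.
have [x [_ [Wx _ _]]] := uncountable_two ncW; apply: ncW.
have c : countable (range (fun m => flip 0 (flip m x))).
  by apply: sub_countable (card_image_le _ _) _; exact: countableP.
apply: sub_countable c; apply: subset_card_le => y Wy.
have [m /= e] := hW x y Wx Wy; exists m => //.
by rewrite -e flipK.
Qed.

End SmoothTopology.

(** A function f obtained for the topology of [smooth_code] is used again with
    the usual topology on its domain, where the potential class of adjacency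
    is larger. *)
Theorem no_set_class (R : realType) (C : fun_class) :
  ~ characterizes_inclusion R (top_of_fun_class C).
Proof.
move=> charC; have [b [b_inj b_surj]] := ev_rep_bijection.
pose S := smooth_cantor b.
have cS := smooth_coded b_inj b_surj.
have [pK _] := cantor_zd_polish R.
have [pS _] : zd_polish R S := coded_zd_polish R cS.
have [GH least] := adjacent_smooth_class b_inj b_surj R.
have bS : borel (bit_adjacent : set (S * S)).
  by apply: closed_borel; exact: adjacent_smooth_closed.
have bK : borel (bit_adjacent : set (cantor * cantor)).
  by rewrite -[bit_adjacent]setCK; apply: borelC; exact: adjacentC_borel.
have [f [Cf fE]] : exists f : S * S -> S * S,
    top_of_fun_class C f /\ bit_adjacent = f @^-1` bit_adjacent.
  apply/(charC S S S S pS pS pS pS bit_adjacent bit_adjacent bS bS).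
  by eexists; eexists; split; [exact: GH|exact: GH|].
have [GA [GB [[_ pA _] pB sub]]] : potential_wadge_class_le R
    (bit_adjacent : set (cantor * cantor)) (bit_adjacent : set (S * S)).
  apply/(charC cantor cantor S S pK pK pS pS bit_adjacent bit_adjacent bK bS).
  by exists f.
have [s [t [[fs [ps _]] [ft [pt _]] /sub/(least _ pB)[_ _]]]] := pA.
move=> [psi /continuousP cpsi aE].
have [a [sa ta]] := finer_polish_flip fs ps ft pt.
have oN : open (~` bit_adjacent : set (space_of s * space_of t)).
  by rewrite aE preimage_setC; apply: cpsi; exact: adjacent_smooth_closed.
have [U [V [oU oV Ua Va UV]]] := (prod_openP _).1 oN (a, a) (@adjacent_irrefl a).
have [N hN] := ta V oV Va.
exact: (UV a (flip N a) Ua (hN N (leqnn N)) (adjacent_flip N a)).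
Qed.

(* If membership in C may depend on the topologies, the restriction to Borel
   functions cannot be dropped: the axiom of choice yields such a class
   containing wild bijections, for which the equivalence holds. *)
Theorem mainTheorem2 (R : realType) :
  ~ (exists C : fun_class, characterizes_inclusion R (top_of_fun_class C)) /\
  ~ (exists C : top_fun_class,
       borel_fun_class R C /\ characterizes_inclusion R C).
Proof.
by split=> [[C /no_set_class]|[C [/no_borel_class h /h]]].
Qed.
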